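(* Let $\mathcal H=\mathbb C^d$, $\mathcal K=\mathbb C^k$, let $\mathscr V^{\rm irr}$ be the (non-empty) manifold of isometries $V:\mathcal H\to\mathcal H\otimes\mathcal K$ whose channel $\mathcal T_V$ is irreducible, and let the compact Lie group $\mathscr G=U(1)\times PU(d)$ act on $\mathscr V^{\rm irr}$ by $g\cdot V=\overline c\,(W\otimes\mathbf 1_{\mathcal K})VW^*$ for $g=(c,W)$. Then: 1. The action of $\mathscr G$ on $\mathscr V^{\rm irr}$ is effective and almost free. 2. For $V\in\mathscr V^{\rm irr}$, if $p_V$ is the period of $\mathcal T_V$, $\gamma_V:=e^{2\pi i/p_V}$, and $Z_V$ is the unitary eigenvector of $\mathcal T_V$ with eigenvalue $\gamma_V$, then the stabiliser of $V$ is $$\mathscr G_V=\{(\gamma_V^j,Z_V^j):\ j=0,\dots,p_V-1\}\simeq\mathbb Z_{p_V}.$$ 3. $\mathscr P^{\rm irr}=\mathscr V^{\rm irr}/\mathscr G$ as topological spaces, where $\mathscr P^{\rm irr}$ is the quotient of $\mathscr V^{\rm irr}$ by output equivalence.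
   Context: For an isometry $V:\mathcal H\to\mathcal H\otimes\mathcal K$, the channel is $\mathcal T_V(X)=V^*(X\otimes\mathbf 1_{\mathcal K})V$ on $L^\infty(\mathcal H)$, with predual $\mathcal T_{V*}(\rho)={\rm Tr}_{\mathcal K}(V\rho V^* )$. It is irreducible if there is a unique state $\rho_V^{\rm ss}>0$ with $\mathcal T_{V*}(\rho_V^{\rm ss})=\rho_V^{\rm ss}$. For irreducible $\mathcal T_V$ the eigenvalues of modulus one are exactly $\{\gamma_V^j\}_{j=0}^{p_V-1}$, $\gamma_V=e^{2\pi i/p_V}$, for some integer $p_V\ge1$ (the period); they are algebraically simple, and there is a decomposition $\mathcal H=\bigoplus_{a=0}^{p_V-1}\mathcal H_a$ with orthogonal projections $P_a$ such that $\mathcal T_V(P_{a\oplus1})=P_a$ ($\oplus$ is addition mod $p_V$) and $Z_V=\sum_a\gamma_V^aP_a$ satisfies $\mathcal T_V(Z_V^j)=\gamma_V^jZ_V^j$. The set of all isometries is a submanifold of $L^\infty(\mathcal H,\mathcal H\otimes\mathcal K)$, and $\mathscr V^{\rm irr}$ is an open subset of it. Elements of $PU(d)$ are unitaries modulo a phase (the action does not depend on the representative; $Z_V^j$ in the stabiliser is understood as a class in $PU(d)$). The stabiliser is $\mathscr G_V=\{g\in\mathscr G:g\cdot V=V\}$. The action is almost free if every $\mathscr G_V$ is finite, and effective if $\bigcap_{V}\mathscr G_V=\{(1,\mathbf 1)\}$. Output equivalence: write $V|\psi\rangle=\sum_iK_i|\psi\rangle\otimes|i\rangle$ and $V(n)|\psi\rangle=\sum_{i_1,\dots,i_n}K_{i_n}\cdots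 K_{i_1}|\psi\rangle\otimes|i_1\cdots i_n\rangle$. The stationary output is $\rho_V^{\rm out}(n)={\rm Tr}_{\mathcal H}[V(n)\rho_V^{\rm ss}V(n)^*]$. $V_1,V_2\in\mathscr V^{\rm irr}$ are output equivalent if $\rho^{\rm out}_{V_1}(n)=\rho^{\rm out}_{V_2}(n)$ for all $n$. $\mathscr P^{\rm irr}$ is the set of equivalence classes with the quotient topology. *)

(* Defs.v *)
From HB Require Import structures.
From mathcomp Require Import all_boot all_order all_algebra.
From mathcomp Require Import complex mxtens.
From mathcomp Require Import all_classical all_reals all_analysis.
Set Implicit Arguments.
Unset Strict Implicit.
Unset Printing Implicit Defensive.
Import Order.TTheory GRing.Theory Num.Theory.
Import numFieldTopology.Exports numFieldNormedType.Exports.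

Local Open Scope classical_set_scope.
Local Open Scope ring_scope.
Local Open Scope sesquilinear_scope.
Local Open Scope quotient_scope.

(* H = C^d, K = C^k; the basis vector e_a (x) e_i of H (x) K = C^(d * k) is the
   one of index mxtens_index (a, i).  A ^t* is the adjoint and *t the Kronecker
   product.  Naming the complex numbers as a numClosedFieldType makes matrices
   over them inherit their usual topology. *)
Definition Cplx (R : realType) : numClosedFieldType := complex R.

Section Adjoint.
Variable C : numClosedFieldType.

Lemma adjmxM m n p (A : 'M[C]_(m, n)) (B : 'M[C]_(n, p)) :
  (A *m B) ^t* = B ^t* *m A ^t*.
Proof. by rewrite trmx_mul map_mxM. Qed.

Lemma adjmxZ m n (a : C) (A : 'M[C]_(m, n)) : (a *: A) ^t* = a^* *: A ^t*.
Proof. by apply/matrixP => i j; rewrite !mxE rmorphM. Qed.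

Lemma adjmx1 n : (1%:M : 'M[C]_n) ^t* = 1%:M.
Proof. by rewrite trmx1 map_mx1. Qed.

Lemma adjmx_tens1 m n k (A : 'M[C]_(m, n)) :
  (A *t (1%:M : 'M[C]_k)) ^t* = A ^t* *t 1%:M.
Proof. by rewrite trmx_tens map_mxT trmx1 map_mx1. Qed.

Lemma tensmx1M m n p k (A : 'M[C]_(m, n)) (B : 'M[C]_(n, p)) :
  (A *m B) *t (1%:M : 'M[C]_k) = (A *t 1%:M) *m (B *t 1%:M).
Proof. by rewrite tensmx_mul mulmx1. Qed.

Lemma tensmx11 m k : (1%:M : 'M[C]_m) *t (1%:M : 'M[C]_k) = 1%:M.
Proof.
apply/matrixP => x y; case: (mxtens_indexP x) => a i.
case: (mxtens_indexP y) => b j; rewrite tensmxE !mxE.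
rewrite (can_eq (@mxtens_indexK m k)) xpair_eqE.
by rewrite -natrM mulnb.
Qed.

End Adjoint.

Section Groups.
Variables (R : realType) (d : nat).
Local Notation C := (Cplx R).

Record circle := Circle { circle_val :> C; _ : `|circle_val| == 1 }.
HB.instance Definition _ := [isSub for circle_val].
HB.instance Definition _ := [Choice of circle by <:].

Lemma circle_norm (c : circle) : `|c : C| = 1.
Proof. by case: c => c /= /eqP. Qed.

Lemma circle_neq0 (c : circle) : (c : C) != 0.
Proof. by rewrite -normr_eq0 circle_norm oner_eq0. Qed.

Lemma circle_mulJ (c : circle) : (c : C) * (c : C)^* = 1.
Proof. by rewrite -normCK circle_norm expr1n. Qed.

Fact circle_one_subproof : `|1 : C| == 1. Proof. by rewrite normr1. Qed.
Fact circle_mul_subproof (a b : circle) : `|(a : C) * (b : C)| == 1.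
Proof. by rewrite normrM !circle_norm mulr1. Qed.
Fact circle_inv_subproof (a : circle) : `|(a : C)^*| == 1.
Proof. by rewrite norm_conjC circle_norm. Qed.

Definition circle_one := Circle circle_one_subproof.
Definition circle_mul a b := Circle (circle_mul_subproof a b).
Definition circle_inv a := Circle (circle_inv_subproof a).

Fact circle_mulA : associative circle_mul.
Proof. by move=> a b c; apply: val_inj; rewrite /= mulrA. Qed.
Fact circle_mul1g : left_id circle_one circle_mul.
Proof. by move=> a; apply: val_inj; rewrite /= mul1r. Qed.
Fact circle_mulg1 : right_id circle_one circle_mul.
Proof. by move=> a; apply: val_inj; rewrite /= mulr1. Qed.
Fact circle_mulVg : left_inverse circle_one circle_inv circle_mul.
Proof. by move=> a; apply: val_inj; rewrite /= mulrC circle_mulJ. Qed.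
Fact circle_mulgV : right_inverse circle_one circle_inv circle_mul.
Proof. by move=> a; apply: val_inj; rewrite /= circle_mulJ. Qed.
HB.instance Definition _ := isGroup.Build circle circle_mulA circle_mul1g
  circle_mulg1 circle_mulVg circle_mulgV.

Record unitary :=
  Unitary { unitary_mx :> 'M[C]_d; _ : unitary_mx \is unitarymx }.
HB.instance Definition _ := [isSub for unitary_mx].
HB.instance Definition _ := [Choice of unitary by <:].

Lemma unitary_mulJ (W : unitary) : (W : 'M[C]_d) *m (W : 'M[C]_d) ^t* = 1%:M.
Proof. by case: W => W /= /unitarymxP. Qed.

Lemma unitary_Jmul (W : unitary) : (W : 'M[C]_d) ^t* *m (W : 'M[C]_d) = 1%:M.
Proof. exact: mulmx1C (unitary_mulJ W). Qed.

Fact unitary_one_subproof : (1%:M : 'M[C]_d) \is unitarymx.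
Proof. by apply/unitarymxP; rewrite adjmx1 mulmx1. Qed.
Fact unitary_mul_subproof (A B : unitary) :
  (A : 'M[C]_d) *m (B : 'M[C]_d) \is unitarymx.
Proof.
apply/unitarymxP; rewrite adjmxM mulmxA -(mulmxA (A : 'M[C]_d)).
by rewrite unitary_mulJ mulmx1 unitary_mulJ.
Qed.
Fact unitary_inv_subproof (A : unitary) : (A : 'M[C]_d) ^t* \is unitarymx.
Proof. by apply/unitarymxP; rewrite trmxCK unitary_Jmul. Qed.

Definition unitary_one := Unitary unitary_one_subproof.
Definition unitary_mul A B := Unitary (unitary_mul_subproof A B).
Definition unitary_inv A := Unitary (unitary_inv_subproof A).

Fact unitary_mulA : associative unitary_mul.
Proof. by move=> A B D; apply: val_inj; rewrite /= mulmxA. Qed.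
Fact unitary_mul1g : left_id unitary_one unitary_mul.
Proof. by move=> A; apply: val_inj; rewrite /= mul1mx. Qed.
Fact unitary_mulg1 : right_id unitary_one unitary_mul.
Proof. by move=> A; apply: val_inj; rewrite /= mulmx1. Qed.
Fact unitary_mulVg : left_inverse unitary_one unitary_inv unitary_mul.
Proof. by move=> A; apply: val_inj; rewrite /= unitary_Jmul. Qed.
Fact unitary_mulgV : right_inverse unitary_one unitary_inv unitary_mul.
Proof. by move=> A; apply: val_inj; rewrite /= unitary_mulJ. Qed.
HB.instance Definition _ := isGroup.Build unitary unitary_mulA unitary_mul1g
  unitary_mulg1 unitary_mulVg unitary_mulgV.

Definition phase_rel (A B : unitary) : bool :=
  `[< exists c : circle, (B : 'M[C]_d) = (c : C) *: (A : 'M[C]_d) >].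

Fact phase_refl : reflexive phase_rel.
Proof. by move=> A; apply/asboolP; exists 1%g; rewrite scale1r. Qed.
Fact phase_sym : symmetric phase_rel.
Proof.
suff H A B : phase_rel A B -> phase_rel B A by move=> A B; apply/idP/idP; exact: H.
move=> /asboolP[c Bc]; apply/asboolP; exists (c^-1)%g.
by rewrite Bc scalerA /= mulrC circle_mulJ scale1r.
Qed.
Fact phase_trans : transitive phase_rel.
Proof.
move=> B A D /asboolP[c Bc] /asboolP[e De]; apply/asboolP; exists (e * c)%g.
by rewrite De Bc scalerA.
Qed.
Canonical phase_equiv := EquivRel phase_rel phase_refl phase_sym phase_trans.

Definition PU := {eq_quot phase_equiv}.
HB.instance Definition _ := Choice.on PU.
HB.instance Definition _ := EqQuotient.on PU.

Lemma PU_eqP (A B : unitary) :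
  (\pi_PU A = \pi_PU B) <->
  exists c : circle, (B : 'M[C]_d) = (c : C) *: (A : 'M[C]_d).
Proof. by split=> [/eqmodP/asboolP//|h]; apply/eqmodP/asboolP. Qed.

Definition PU_one : PU := \pi_PU (1%g : unitary).
Definition PU_mul (x y : PU) : PU := \pi_PU (repr x * repr y)%g.
Definition PU_inv (x : PU) : PU := \pi_PU ((repr x)^-1)%g.

Lemma PU_mulE (A B : unitary) : PU_mul (\pi A) (\pi B) = \pi_PU (A * B)%g.
Proof.
rewrite /PU_mul; case: (piP PU A) => A' /PU_eqP[c cA].
case: (piP PU B) => B' /PU_eqP[e eB].
apply/esym/PU_eqP; exists (c * e)%g.
by rewrite /= cA eB -scalemxAl -scalemxAr scalerA.
Qed.

Lemma PU_invE (A : unitary) : PU_inv (\pi A) = \pi_PU (A^-1)%g.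
Proof.
rewrite /PU_inv; case: (piP PU A) => A' /PU_eqP[c cA].
by apply/esym/PU_eqP; exists (c^-1)%g; rewrite /= cA adjmxZ.
Qed.

Fact PU_mulA : associative PU_mul.
Proof.
by elim/quotW=> A; elim/quotW=> B; elim/quotW=> D; rewrite !PU_mulE mulgA.
Qed.
Fact PU_mul1g : left_id PU_one PU_mul.
Proof. by elim/quotW=> A; rewrite PU_mulE mul1g. Qed.
Fact PU_mulg1 : right_id PU_one PU_mul.
Proof. by elim/quotW=> A; rewrite PU_mulE mulg1. Qed.
Fact PU_mulVg : left_inverse PU_one PU_inv PU_mul.
Proof. by elim/quotW=> A; rewrite PU_invE PU_mulE mulVg. Qed.
Fact PU_mulgV : right_inverse PU_one PU_inv PU_mul.
Proof. by elim/quotW=> A; rewrite PU_invE PU_mulE mulgV. Qed.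
HB.instance Definition _ := isGroup.Build PU PU_mulA PU_mul1g
  PU_mulg1 PU_mulVg PU_mulgV.

(* The componentwise group structure is the library's instance on pairs. *)
Definition gauge_group := (circle * PU)%type.

End Groups.

Section Channels.
Variables (R : realType) (d k : nat).
Local Notation C := (Cplx R).
Implicit Types (V : 'M[C]_(d * k, d)) (rho X : 'M[C]_d).

(* Over the complex numbers 0 <= z entails that z is real, so both predicates
   force A to be Hermitian. *)
Definition psdmx n (A : 'M[C]_n) : Prop :=
  forall v : 'cV[C]_n, 0 <= (v ^t* *m A *m v) 0 0.
Definition pdmx n (A : 'M[C]_n) : Prop :=
  forall v : 'cV[C]_n, v != 0 -> 0 < (v ^t* *m A *m v) 0 0.

Definition is_state rho : Prop := psdmx rho /\ \tr rho = 1.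

(* The digit is the tensor factor that is traced out. *)
Definition ptrace2 m n (X : 'M[C]_(m * n)) : 'M[C]_m :=
  \matrix_(a, b) \sum_(i < n) X (mxtens_index (a, i)) (mxtens_index (b, i)).
Definition ptrace1 m n (X : 'M[C]_(m * n)) : 'M[C]_n :=
  \matrix_(i, j) \sum_(a < m) X (mxtens_index (a, i)) (mxtens_index (a, j)).

Definition isometry V : Prop := V ^t* *m V = 1%:M.

Definition channel V X : 'M[C]_d := V ^t* *m (X *t (1%:M : 'M[C]_k)) *m V.
Definition channel_predual V rho : 'M[C]_d := ptrace2 (V *m rho *m V ^t*).

(* The uniqueness below is among positive definite states; it entails uniqueness
   among all states, since the mean of a positive definite invariant state and
   of any other invariant state is again positive definite and invariant. *)
Definition stationary_state V rho : Prop :=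
  [/\ is_state rho, pdmx rho & channel_predual V rho = rho].

Definition irreducible_channel V : Prop := exists! rho, stationary_state V rho.

Definition Virr : set 'M[C]_(d * k, d) :=
  [set V | isometry V /\ irreducible_channel V].

(* rho_V^ss; the default value 0 is irrelevant on Virr *)
Definition rho_ss V : 'M[C]_d := xget 0 [set rho | stationary_state V rho].

Definition channel_eigenvalue V (a : C) : Prop :=
  exists2 X : 'M[C]_d, X != 0 & channel V X = a *: X.

Definition kraus V (i : 'I_k) : 'M[C]_d :=
  \matrix_(a, b) V (mxtens_index (a, i)) b.

(* K_{i_n} ... K_{i_1} for w = (i_1, ..., i_n) *)
Definition kraus_word V (w : seq 'I_k) : 'M[C]_d :=
  foldl (fun A i => kraus V i *m A) 1%:M w.

(* The canonical basis of K^{(x) n} is indexed by n-tuples of indices,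
   numbered by enum_rank. *)
Definition Vn V n : 'M[C]_(d * #|{: n.-tuple 'I_k}|, d) :=
  \matrix_(x, b)
    let w : n.-tuple 'I_k := enum_val (mxtens_unindex x).2 in
    kraus_word V w (mxtens_unindex x).1 b.

Definition rho_out V n : 'M[C]_(#|{: n.-tuple 'I_k}|) :=
  ptrace1 (Vn V n *m rho_ss V *m (Vn V n) ^t*).

End Channels.

Arguments psdmx {R n} A.
Arguments pdmx {R n} A.
Arguments Virr R d k : clear implicits.

Section Period.
Variable R : realType.
Local Notation C := (Cplx R).

Fact cis_subproof (x : R) : `|(Complex (cos x) (sin x) : C)| == 1.
Proof. by rewrite normc_def /= cos2Dsin2 sqrtr1. Qed.
Definition cis (x : R) : circle R := Circle (cis_subproof x).

Definition gamma (p : nat) : circle R := cis (2 * pi / p%:R).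

Definition is_period d k (V : 'M[C]_(d * k, d)) (p : nat) : Prop :=
  (0 < p)%N /\
  forall a : C, (`|a| = 1 /\ channel_eigenvalue V a) <->
                exists2 j, (j < p)%N & a = (gamma p : C) ^+ j.

(* Z is a unitary eigenvector of the channel with eigenvalue gamma_p; it is
   determined up to a phase. *)
Definition is_Z d k (V : 'M[C]_(d * k, d)) (p : nat) (Z : unitary R d) : Prop :=
  channel V Z = (gamma p : C) *: (Z : 'M[C]_d).

End Period.

Section Action.
Variables (R : realType) (d k : nat).
Local Notation C := (Cplx R).
Implicit Types (V : 'M[C]_(d * k, d)) (c : circle R) (W : unitary R d).

Definition act_mx c W V : 'M[C]_(d * k, d) :=
  (c : C)^* *: (((W : 'M[C]_d) *t (1%:M : 'M[C]_k)) *m V *m (W : 'M[C]_d) ^t*).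

Lemma act_mx1 V : act_mx 1%g 1%g V = V.
Proof.
by rewrite /act_mx /= rmorph1 scale1r tensmx11 mul1mx adjmx1 mulmx1.
Qed.

Lemma act_mxM c e W U V :
  act_mx (c * e)%g (W * U)%g V = act_mx c W (act_mx e U V).
Proof.
rewrite /act_mx /= rmorphM tensmx1M adjmxM -scalemxAr -scalemxAl scalerA.
by rewrite !mulmxA.
Qed.

Lemma act_mx_phase c (e : circle R) W (U : unitary R d) V :
  (U : 'M[C]_d) = (e : C) *: (W : 'M[C]_d) -> act_mx c U V = act_mx c W V.
Proof.
move=> eU; rewrite /act_mx eU adjmxZ; congr (_ *: _).
have -> : ((e : C) *: (W : 'M[C]_d)) *t (1%:M : 'M[C]_k) = (e : C) *: (W *t 1%:M).
  by apply/matrixP => x y; rewrite !mxE mulrA.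
by rewrite -!scalemxAl -scalemxAr scalerA circle_mulJ scale1r.
Qed.

Lemma sum_tens1 m (F : 'I_(m * k) -> C) (f : 'I_m -> C) (i : 'I_k) :
  \sum_x f (mxtens_unindex x).1 * ((i == (mxtens_unindex x).2)%:R) * F x =
  \sum_a f a * F (mxtens_index (a, i)).
Proof.
pose G (q : 'I_m * 'I_k) := f q.1 * (i == q.2)%:R * F (mxtens_index q).
transitivity (\sum_q G q).
  rewrite (reindex (@mxtens_index m k)); last first.
    by exists (@mxtens_unindex m k) => x _; rewrite (mxtens_indexK, mxtens_unindexK).
  by apply: eq_bigr => q _; rewrite mxtens_indexK.
transitivity (\sum_a \sum_j G (a, j)).
  by rewrite pair_big /=; apply: eq_bigr => -[].
apply: eq_bigr => a _.
rewrite (bigD1 i) //= big1 /G /= ?addr0 ?eqxx ?mulr1 // => j /negPf ji.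
by rewrite eq_sym ji mulr0 mul0r.
Qed.

Lemma ptrace2_mull (A : 'M[C]_d) (X : 'M[C]_(d * k)) :
  ptrace2 ((A *t 1%:M) *m X) = A *m ptrace2 X.
Proof.
apply/matrixP => a b; rewrite !mxE.
under [RHS]eq_bigr do rewrite mxE mulr_sumr.
rewrite exchange_big /=; apply: eq_bigr => i _; rewrite !mxE.
rewrite -(sum_tens1 (fun x => X x (mxtens_index (b, i))) (A a) i).
by apply: eq_bigr => x _; rewrite !mxE mxtens_indexK.
Qed.

Lemma ptrace2_adj (X : 'M[C]_(d * k)) : ptrace2 (X ^t*) = (ptrace2 X) ^t*.
Proof.
apply/matrixP => a b; rewrite !mxE rmorph_sum.
by apply: eq_bigr => i _; rewrite !mxE.
Qed.

Lemma ptrace2_mulr (A : 'M[C]_d) (X : 'M[C]_(d * k)) :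
  ptrace2 (X *m (A *t 1%:M)) = ptrace2 X *m A.
Proof.
rewrite -[X in ptrace2 X]trmxCK ptrace2_adj adjmxM adjmx_tens1 ptrace2_mull.
by rewrite ptrace2_adj adjmxM !trmxCK.
Qed.

Lemma channel_predual_act c W V (rho : 'M[C]_d) :
  channel_predual (act_mx c W V) ((W : 'M[C]_d) *m rho *m (W : 'M[C]_d) ^t*) =
  (W : 'M[C]_d) *m channel_predual V rho *m (W : 'M[C]_d) ^t*.
Proof.
rewrite /channel_predual -ptrace2_mull -ptrace2_mulr /act_mx.
rewrite adjmxZ -!scalemxAl -!scalemxAr scalerA conjCK mulrC circle_mulJ scale1r.
rewrite !adjmxM trmxCK adjmx_tens1 !mulmxA.
by do 2![rewrite -[_ *m _ ^t* *m (W : 'M[C]_d)]mulmxA unitary_Jmul mulmx1].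
Qed.

Lemma stationary_act c W V (rho : 'M[C]_d) : stationary_state V rho ->
  stationary_state (act_mx c W V) ((W : 'M[C]_d) *m rho *m (W : 'M[C]_d) ^t*).
Proof.
have E (v : 'cV[C]_d) : v ^t* *m ((W : 'M[C]_d) *m rho *m (W : 'M[C]_d) ^t*) *m v =
    ((W : 'M[C]_d) ^t* *m v) ^t* *m rho *m ((W : 'M[C]_d) ^t* *m v).
  by rewrite adjmxM trmxCK !mulmxA.
move=> [[rho0 rho1] rhop rhoV]; split; last by rewrite channel_predual_act rhoV.
  split; first by move=> v; rewrite E.
  by rewrite mxtrace_mulC mulmxA unitary_Jmul mul1mx.
move=> v v0; rewrite E; apply: rhop; apply: contra_neq v0 => Wv0.
by rewrite -[v]mul1mx -(unitary_mulJ W) -mulmxA Wv0 mulmx0.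
Qed.

Lemma Virr_act c W V : Virr R d k V -> Virr R d k (act_mx c W V).
Proof.
move=> [Viso [rho [rhoV uniq_rho]]]; split.
  rewrite /isometry /act_mx adjmxZ -scalemxAl -scalemxAr scalerA conjCK.
  rewrite circle_mulJ scale1r !adjmxM trmxCK adjmx_tens1.
  rewrite -!mulmxA (mulmxA (_ *t _) (_ *t _)) -tensmx1M unitary_Jmul tensmx11.
  by rewrite mul1mx (mulmxA (V ^t*)) Viso mul1mx unitary_mulJ.
exists ((W : 'M[C]_d) *m rho *m (W : 'M[C]_d) ^t*); split; first exact: stationary_act.
move=> sigma /(stationary_act (c^-1)%g (W^-1)%g).
rewrite -act_mxM !mulVg act_mx1 => /uniq_rho ->.
rewrite /= trmxCK !mulmxA unitary_mulJ mul1mx -mulmxA unitary_mulJ.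
by rewrite mulmx1.
Qed.

(* By val_act the choice of a representative of g.2 is immaterial. *)
Definition act (g : gauge_group R d) (V : Virr R d k) : Virr R d k :=
  exist _ (act_mx g.1 (repr g.2) (val V))
    (mem_set (Virr_act g.1 (repr g.2) (set_mem (valP V)))).

Lemma val_act c W (V : Virr R d k) : val (act (c, \pi W) V) = act_mx c W (val V).
Proof.
by rewrite /=; case: (piP (PU R d) W) => W' /PU_eqP[e /act_mx_phase].
Qed.

Lemma act1 (V : Virr R d k) : act 1%g V = V.
Proof. by apply: val_inj; rewrite val_act act_mx1. Qed.

Lemma actM g h (V : Virr R d k) : act (g * h)%g V = act g (act h V).
Proof.
case: g => c; elim/quotW => W; case: h => e; elim/quotW => U; apply: val_inj.
have -> : ((c, \pi_(PU R d) W) * (e, \pi_(PU R d) U))%g =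
    ((c * e)%g, \pi_(PU R d) (W * U)%g).
  by rewrite -PU_mulE.
by rewrite !val_act act_mxM.
Qed.

Definition stabiliser (V : Virr R d k) : set (gauge_group R d) :=
  [set g | act g V = V].

Definition effective_action : Prop :=
  \bigcap_(V in [set: Virr R d k]) stabiliser V = [set 1%g].

Definition almost_free_action : Prop :=
  forall V : Virr R d k, finite_set (stabiliser V).

Definition same_orbit (V1 V2 : Virr R d k) : bool :=
  `[< exists g, V2 = act g V1 >].

Fact same_orbit_refl : reflexive same_orbit.
Proof. by move=> V; apply/asboolP; exists 1%g; rewrite act1. Qed.
Fact same_orbit_sym : symmetric same_orbit.
Proof.
suff H (V1 V2 : Virr R d k) : same_orbit V1 V2 -> same_orbit V2 V1.
  by move=> V1 V2; apply/idP/idP; exact: H.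
by move=> /asboolP[g ->]; apply/asboolP; exists (g^-1)%g; rewrite -actM mulVg act1.
Qed.
Fact same_orbit_trans : transitive same_orbit.
Proof.
move=> V2 V1 V3 /asboolP[g ->] /asboolP[h ->]; apply/asboolP.
by exists (h * g)%g; rewrite actM.
Qed.
Canonical same_orbit_equiv :=
  EquivRel same_orbit same_orbit_refl same_orbit_sym same_orbit_trans.

Definition output_equivalent (V1 V2 : Virr R d k) : bool :=
  `[< forall n, rho_out (val V1) n = rho_out (val V2) n >].

Fact output_equivalent_refl : reflexive output_equivalent.
Proof. by move=> V; apply/asboolP. Qed.
Fact output_equivalent_sym : symmetric output_equivalent.
Proof.
suff H (V1 V2 : Virr R d k) :
    output_equivalent V1 V2 -> output_equivalent V2 V1.
  by move=> V1 V2; apply/idP/idP; exact: H.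
by move=> /asboolP h; apply/asboolP => n; exact/esym/h.
Qed.
Fact output_equivalent_trans : transitive output_equivalent.
Proof.
move=> V2 V1 V3 /asboolP h /asboolP h'; apply/asboolP.
by have H n := eq_trans (h n) (h' n).
Qed.
Canonical output_equiv := EquivRel output_equivalent
  output_equivalent_refl output_equivalent_sym output_equivalent_trans.

(* Virr carries the topology induced by the ambient space of matrices, and both
   quotients the corresponding quotient topology. *)
Definition orbit_space : topologicalType :=
  quotient_topology {eq_quot same_orbit_equiv}.
Definition Pirr : topologicalType :=
  quotient_topology {eq_quot output_equiv}.

Definition orbit_class (V : Virr R d k) : orbit_space :=
  \pi_{eq_quot same_orbit_equiv} V.
Definition output_class (V : Virr R d k) : Pirr :=
  \pi_{eq_quot output_equiv} V.

End Action.

Arguments stabiliser {R d k} V.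
Arguments effective_action R d k : clear implicits.
Arguments almost_free_action R d k : clear implicits.
Arguments orbit_space R d k : clear implicits.
Arguments Pirr R d k : clear implicits.

Definition homeomorphism (X Y : topologicalType) (f : X -> Y) : Prop :=
  continuous f /\
  exists g : Y -> X, [/\ cancel f g, cancel g f & continuous g].

(* The subset S of the group G is isomorphic to Z/pZ, the latter being 'I_p
   with addition modulo p. *)
Definition isog_Zmod (G : groupType) (S : set G) (p : nat) : Prop :=
  exists f : 'I_p -> G,
    [/\ injective f, range f = S
      & forall i j l : 'I_p, (l = i + j %[mod p])%N -> f l = (f i * f j)%g].

(* Main.v *)
Require Import Defs.
From HB Require Import structures.
From mathcomp Require Import all_boot all_order all_algebra.
From mathcomp Require Import complex mxtens ring.
From mathcomp Require Import all_classical all_reals all_analysis.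
Set Implicit Arguments.
Unset Strict Implicit.
Unset Printing Implicit Defensive.
Import Order.TTheory GRing.Theory Num.Theory.
Import numFieldTopology.Exports numFieldNormedType.Exports.
Local Open Scope classical_set_scope.
Local Open Scope ring_scope.
Local Open Scope sesquilinear_scope.
Local Open Scope quotient_scope.

(* For two isometries put [T X = V1^* (X (x) 1) V2].  If [V2] has a faithful
   invariant state, [T] is a contraction for the Hilbert norm [tr (rho X^* X)], and
   an eigenvector [X] with eigenvalue [c], [|c| >= 1], forces [|c| = 1] and
   [(X (x) 1) V2 = c V1 X].  Then [X^* X] is a fixed point of the channel of [V2],
   hence scalar by irreducibility, so [X] is a multiple of a unitary [W] and
   [V1 = (c, W) . V2].

   For [V1 = V2 = V] this identifies the stabiliser with the pairs [(c, W)] such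
   that [W] is a unitary eigenvector of eigenvalue [c], with [W] determined by [c]
   up to a phase; the peripheral eigenvalues form a finite subgroup of the circle.
   An element [(c, W)] fixing every [V] has [W] commuting in [PU(d)] with all
   unitaries, hence is trivial.

   If [V1] and [V2] are output equivalent, [T] has an eigenvalue of modulus at least
   one: otherwise the powers of [T] tend to [0], which makes the two [n]-step
   outputs asymptotically orthogonal, whereas they are one and the same state of
   rank at most [d^2]. *)

(** * Positive forms on matrices *)

Section PositiveForms.
Variable R : realType.
Local Notation C := (Cplx R).

Lemma psdmx_sandwich_ge0 d m (rho : 'M[C]_d) (D : 'M[C]_(m, d)) i :
  psdmx rho -> 0 <= (D *m rho *m D ^t*) i i.
Proof.
move=> /(_ ((row i D) ^t*)); rewrite trmxCK.
suff -> : (row i D *m rho *m (row i D) ^t*) 0 0 = (D *m rho *m D ^t*) i i by [].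
by rewrite -row_mul !mxE; apply: eq_bigr => j _; rewrite !mxE.
Qed.

Lemma psdmx_tr_sandwich_ge0 d m (rho : 'M[C]_d) (D : 'M[C]_(m, d)) :
  psdmx rho -> 0 <= \tr (D *m rho *m D ^t*).
Proof. by move=> rho0; apply: sumr_ge0 => i _; exact: psdmx_sandwich_ge0. Qed.

Lemma pdmx_psd d (rho : 'M[C]_d) : pdmx rho -> psdmx rho.
Proof.
move=> rhop v; have [->|/rhop/ltW//] := eqVneq v 0.
by rewrite mulmx0 mxE.
Qed.

(** The diagonal entries of [D rho D^*] are values of the form [rho] on the adjoint rows of [D]:
    nonnegative with zero sum, they all vanish, and definiteness kills each row. *)
Lemma pdmx_tr_sandwich_eq0 d m (rho : 'M[C]_d) (D : 'M[C]_(m, d)) :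
  pdmx rho -> \tr (D *m rho *m D ^t*) = 0 -> D = 0.
Proof.
move=> rhop D0; apply/row_matrixP => i; rewrite row0.
have /eqP : (D *m rho *m D ^t*) i i = 0.
  have := @psumr_eq0P _ _ xpredT (fun i => (D *m rho *m D ^t*) i i).
  by apply=> // j _; apply/psdmx_sandwich_ge0/pdmx_psd.
apply: contraTeq => Di0.
have v0 : (row i D) ^t* != 0.
  by apply: contra_neq Di0 => h; rewrite -[row i D]trmxCK h linear0 map_mx0.
have := rhop _ v0; rewrite trmxCK.
suff -> : (row i D *m rho *m (row i D) ^t*) 0 0 = (D *m rho *m D ^t*) i i.
  by move/lt0r_neq0.
by rewrite -row_mul !mxE; apply: eq_bigr => j _; rewrite !mxE.
Qed.

Lemma pdmx_tr_sandwich_gt0 d m (rho : 'M[C]_d) (D : 'M[C]_(m, d)) :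
  pdmx rho -> D != 0 -> 0 < \tr (D *m rho *m D ^t*).
Proof.
move=> rhop D0; rewrite lt0r psdmx_tr_sandwich_ge0 ?andbT; last exact: pdmx_psd.
by apply: contra_neq D0; exact: pdmx_tr_sandwich_eq0.
Qed.

End PositiveForms.

(** * Transfer maps and the equality case of the contraction *)

Section Transfer.
Variables (R : realType) (d k : nat).
Local Notation C := (Cplx R).
Implicit Types (V : 'M[C]_(d * k, d)) (X rho : 'M[C]_d).

(** For [V1 = V2 = V] this is convertible to [channel V], so that results on its eigenvectors apply
    to the channel. *)
Definition transfer V1 V2 X : 'M[C]_d :=
  V1 ^t* *m (X *t (1%:M : 'M[C]_k)) *m V2.

Lemma tensmx1D (X Y : 'M[C]_d) :
  (X + Y) *t (1%:M : 'M[C]_k) = X *t 1%:M + Y *t 1%:M.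
Proof. by apply/matrixP => i j; rewrite !mxE mulrDl. Qed.

Lemma tensmx1Z (a : C) (X : 'M[C]_d) :
  (a *: X) *t (1%:M : 'M[C]_k) = a *: (X *t 1%:M).
Proof. by apply/matrixP => i j; rewrite !mxE mulrA. Qed.

Lemma transfer_is_linear V1 V2 : linear (transfer V1 V2).
Proof.
move=> a X Y; rewrite /transfer tensmx1D tensmx1Z mulmxDr mulmxDl.
by rewrite -scalemxAr -scalemxAl.
Qed.
HB.instance Definition _ V1 V2 :=
  GRing.isLinear.Build C 'M[C]_d 'M[C]_d _ (transfer V1 V2)
    (transfer_is_linear V1 V2).

Lemma ptrace2_tr (Y : 'M[C]_(d * k)) : \tr (ptrace2 Y) = \tr Y.
Proof.
rewrite /mxtrace; under eq_bigr do rewrite mxE.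
rewrite pair_big (reindex (@mxtens_unindex d k)); last first.
  by exists (@mxtens_index d k) => x _; rewrite (mxtens_indexK, mxtens_unindexK).
by apply: eq_bigr => x _; case: (mxtens_indexP x) => a i; rewrite mxtens_indexK.
Qed.

Lemma tr_channel_predual V rho X :
  \tr (rho *m channel V X) = \tr (channel_predual V rho *m X).
Proof.
rewrite /channel_predual [RHS]mxtrace_mulC -ptrace2_mull ptrace2_tr /channel.
by rewrite [RHS]mxtrace_mulC !mulmxA [LHS]mxtrace_mulC !mulmxA.
Qed.

Lemma mxtrace_sandwich m (rho : 'M[C]_d) (D : 'M[C]_(m, d)) :
  \tr (D *m rho *m D ^t*) = \tr (rho *m (D ^t* *m D)).
Proof. by rewrite [LHS]mxtrace_mulC [RHS]mxtrace_mulC -mulmxA. Qed.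

(* The defect [D] satisfies [tr (rho D^* D) = (1 - |c|^2) tr (rho X^* X)]. *)
Lemma transfer_eigen_intertwine V1 V2 rho X (c : C) :
  Defs.isometry V1 -> stationary_state V2 rho -> X != 0 ->
  transfer V1 V2 X = c *: X -> 1 <= `|c| ->
  `|c| = 1 /\ (X *t 1%:M) *m V2 = c *: (V1 *m X).
Proof.
move=> V1iso [_ rhop rhoV] X0 TX c1.
set D := (X *t 1%:M) *m V2 - c *: (V1 *m X).
have DD : D ^t* *m D = channel V2 (X ^t* *m X) - `|c| ^+ 2 *: (X ^t* *m X).
  have adjB m (A B : 'M[C]_(m, d)) : (A - B) ^t* = A ^t* - B ^t*.
    by apply/matrixP => i j; rewrite !mxE rmorphB.
  have AA : ((X *t 1%:M) *m V2) ^t* *m ((X *t 1%:M) *m V2) =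
      channel V2 (X ^t* *m X).
    by rewrite adjmxM adjmx_tens1 /channel tensmx1M !mulmxA.
  have BA : (V1 *m X) ^t* *m ((X *t 1%:M) *m V2) = c *: (X ^t* *m X).
    by rewrite adjmxM -mulmxA [X in _ *m X]mulmxA -/(transfer V1 V2 X) TX scalemxAr.
  have AB : ((X *t 1%:M) *m V2) ^t* *m (V1 *m X) = c^* *: (X ^t* *m X).
    by rewrite -[LHS]trmxCK adjmxM trmxCK BA adjmxZ adjmxM trmxCK.
  have BB : (V1 *m X) ^t* *m (V1 *m X) = X ^t* *m X.
    by rewrite adjmxM -mulmxA [X in _ *m X]mulmxA V1iso mul1mx.
  (* The two cross terms give [- 2 |c|^2 X^* X], the last one [|c|^2 X^* X]. *)
  rewrite /D adjB adjmxZ mulmxBl !mulmxBr -!scalemxAl -!scalemxAr AA BA AB BB.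
  by rewrite !scalerA -normCK [c^* * c]mulrC -normCK subrr subr0.
have trD : \tr (D *m rho *m D ^t*) = (1 - `|c| ^+ 2) * \tr (X *m rho *m X ^t*).
  rewrite !mxtrace_sandwich DD mulmxBr linearB /= tr_channel_predual rhoV.
  by rewrite -scalemxAr mxtraceZ mulrBl mul1r.
have Xgt0 := pdmx_tr_sandwich_gt0 rhop X0.
have Dge0 := psdmx_tr_sandwich_ge0 D (pdmx_psd rhop).
(* In [trD] the left side is nonnegative and the last factor positive, so [|c|^2 <= 1]. *)
have c1' : `|c| = 1.
  apply/eqP; rewrite eq_le c1 andbT -(@ler_pXn2r _ 2) ?nnegrE //.
  by rewrite expr1n -subr_ge0 -(pmulr_lge0 _ Xgt0) -trD.
split=> //; apply/eqP; rewrite -subr_eq0; apply/eqP.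
apply: (pdmx_tr_sandwich_eq0 rhop); rewrite -/D.
by rewrite trD c1' expr1n subrr mul0r.
Qed.

End Transfer.

(** * Irreducibility: commutant, fixed points and unitary eigenvectors *)

Section Irreducible.
Variables (R : realType) (d k : nat).
Local Notation C := (Cplx R).
Implicit Types (V : 'M[C]_(d * k, d)) (X rho : 'M[C]_d).

Lemma adjmxD m n (A B : 'M[C]_(m, n)) : (A + B) ^t* = A ^t* + B ^t*.
Proof. by apply/matrixP => i j; rewrite !mxE rmorphD. Qed.

(** [X] slides past [V] and [X^*] past [V^*]; acting on the first tensor factor only, both then
    leave the partial trace. *)
Lemma channel_predual_commutant V rho X :
  (X *t 1%:M) *m V = V *m X ->
  channel_predual V (X *m rho *m X ^t*) = X *m channel_predual V rho *m X ^t*.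
Proof.
move=> XV; rewrite /channel_predual -ptrace2_mull -ptrace2_mulr -adjmx_tens1.
by rewrite !mulmxA XV -(mulmxA _ (V ^t*)) -adjmxM XV adjmxM !mulmxA.
Qed.

Lemma channel_predualD V rho sigma :
  channel_predual V (rho + sigma) = channel_predual V rho + channel_predual V sigma.
Proof.
rewrite /channel_predual mulmxDr mulmxDl; apply/matrixP => i j; rewrite !mxE.
by rewrite -big_split; apply: eq_bigr => l _; rewrite mxE.
Qed.

Lemma channel_predualZ V (a : C) rho :
  channel_predual V (a *: rho) = a *: channel_predual V rho.
Proof.
rewrite /channel_predual -scalemxAr -scalemxAl; apply/matrixP => i j.
by rewrite !mxE mulr_sumr; apply: eq_bigr => l _; rewrite mxE.
Qed.

(** [X rho X^*] is invariant but possibly singular; adding [rho] makes it positive definite, and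
    after normalisation uniqueness identifies the sum with a multiple of [rho]. *)
Lemma commutant_invariant V rho X :
  irreducible_channel V -> stationary_state V rho ->
  (X *t 1%:M) *m V = V *m X -> exists a : C, X *m rho *m X ^t* = a *: rho.
Proof.
move=> [rho' [_ uniq]] st XV; have [[rho0 rho1] rhop rhoV] := st.
pose tau := rho + X *m rho *m X ^t*; pose t := \tr tau.
have XX (v : 'cV[C]_d) : v ^t* *m (X *m rho *m X ^t*) *m v =
    (X ^t* *m v) ^t* *m rho *m (X ^t* *m v).
  by rewrite adjmxM trmxCK !mulmxA.
have t0 : 0 < t.
  rewrite /t linearD /= rho1 ltr_pwDl ?ltr01 //.
  exact: psdmx_tr_sandwich_ge0.
have taup : pdmx (t^-1 *: tau).
  move=> v v0; rewrite -scalemxAr -scalemxAl mxE mulr_gt0 ?invr_gt0 //.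
  by rewrite mulmxDr mulmxDl mxE XX ltr_pwDl ?rhop.
have taust : stationary_state V (t^-1 *: tau).
  split=> //; first split; first exact: pdmx_psd.
    by rewrite mxtraceZ mulVf ?gt_eqF.
  by rewrite channel_predualZ channel_predualD channel_predual_commutant ?rhoV.
exists (t - 1); rewrite scalerBl scale1r.
have /(congr1 ( *:%R t)) : t^-1 *: tau = rho by rewrite -(uniq _ taust) -(uniq _ st).
by rewrite scalerA mulfV ?gt_eqF // scale1r => <-; rewrite addrC addKr.
Qed.

(* Polarisation: the previous lemma is applied to [X], [1 + X] and [1 + iX]. *)
Lemma commutant_scalar V X :
  irreducible_channel V -> (X *t 1%:M) *m V = V *m X -> exists a : C, X = a%:M.
Proof.
move=> irr XV; have [rho [st _]] := irr; have [_ rhop _] := st.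
have H := commutant_invariant irr st.
have [l lX] := H _ XV.
(* The cross terms in the expansion for [1 + z X] are what is left once multiples of [rho] are
   subtracted. *)
have E (z : C) : exists m : C, z *: (X *m rho) + z^* *: (rho *m X ^t*) = m *: rho.
  have [|m mX] := H (1%:M + z *: X).
    by rewrite tensmx1D tensmx1Z tensmx11 mulmxDl mulmxDr mul1mx mulmx1
      -scalemxAl -scalemxAr XV.
  exists (m - 1 - z * z^* * l); rewrite !scalerBl scale1r -mX -scalerA -lX.
  rewrite adjmxD adjmxZ adjmx1 !mulmxDl !mulmxDr !mul1mx !mulmx1.
  rewrite -!scalemxAr -!scalemxAl.
  move: (X *m rho *m X ^t*) (X *m rho) (rho *m X ^t*) => A B D.
  by apply/matrixP => i j; rewrite !mxE; ring.
have [m] := E 1; rewrite rmorph1 !scale1r => mE.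
have [n] := E 'i; rewrite conjCi scaleNr -scalerBr => nE.
(* Here [X rho + rho X^* = m rho] and [i X rho - i rho X^* = n rho], whence [X rho = a rho];
   definiteness of [rho] then gives [X = a]. *)
pose a := 2^-1 * (m - 'i * n); exists a.
apply/eqP; rewrite -subr_eq0; apply/eqP; apply: (pdmx_tr_sandwich_eq0 rhop).
suff -> : (X - a%:M) *m rho = 0 by rewrite mul0mx mxtrace0.
rewrite mulmxBl mul_scalar_mx; apply/eqP; rewrite subr_eq0 eq_sym; apply/eqP.
rewrite /a -scalerA scalerBl -['i * n *: _]scalerA -mE -nE.
move: (X *m rho) (rho *m X ^t*) => A B; rewrite scalerA -expr2 sqrCi.
by rewrite scaleN1r opprK addrACA addrN addr0 -mulr2n -[A *+ 2]scaler_nat scalerA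
  mulVf ?pnatr_eq0 // scale1r.
Qed.

(** A fixed point is an eigenvector for the eigenvalue [1], so it intertwines [V] with itself and
    lies in the trivial commutant. *)
Lemma channel_fixed_scalar V X :
  Virr R d k V -> channel V X = X -> exists a : C, X = a%:M.
Proof.
move=> [iso irr] TX; have [->|X0] := eqVneq X 0; first by exists 0; rewrite raddf0.
have [rho [st _]] := irr.
have [||_] := transfer_eigen_intertwine iso st X0 (_ : _ = 1 *: X) _.
- by rewrite scale1r.
- by rewrite normr1.
by rewrite scale1r => /(commutant_scalar irr).
Qed.

Lemma transfer_eigen_unitary V1 V2 X (c : C) :
  Defs.isometry V1 -> Virr R d k V2 -> X != 0 ->
  transfer V1 V2 X = c *: X -> 1 <= `|c| ->
  `|c| = 1 /\ exists a : C, exists W : unitary R d,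
    [/\ a != 0, X = a *: (W : 'M[C]_d) & ((W : 'M[C]_d) *t 1%:M) *m V2 = c *: (V1 *m W)].
Proof.
move=> iso V2irr X0 TX c1; have [iso2 [rho [st _]]] := V2irr.
have [c1' XV] := transfer_eigen_intertwine iso st X0 TX c1; split=> //.
(* Moving [X] past [V2] on both sides produces the factor [c^* c = 1], and [V1^* V1 = 1] removes
   [V1]. *)
have [b XX] : exists b : C, X ^t* *m X = b%:M.
  apply: channel_fixed_scalar V2irr _.
  rewrite /channel tensmx1M -adjmx_tens1 !mulmxA -adjmxM -mulmxA XV adjmxZ adjmxM.
  rewrite -scalemxAl -scalemxAr scalerA mulrC -normCK c1' expr1n scale1r.
  by rewrite !mulmxA -(mulmxA (X ^t*)) iso mulmx1.
(* As [rho] has trace one, [b] is the trace of [X rho X^*], which is positive. *)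
have b0 : 0 < b.
  have [[_ rho1] rhop _] := st; have := pdmx_tr_sandwich_gt0 rhop X0.
  by rewrite mxtrace_sandwich XX mul_mx_scalar mxtraceZ rho1 mulr1.
have s0 : sqrtC b != 0 by rewrite sqrtC_eq0 gt_eqF.
have sr : (sqrtC b)^* = sqrtC b by apply/CrealP/ger0_real; rewrite sqrtC_ge0 ltW.
have Wu : (sqrtC b)^-1 *: X \is unitarymx.
  apply/unitarymxP/mulmx1C; rewrite adjmxZ -scalemxAl -scalemxAr scalerA XX.
  by rewrite rmorphV ?unitfE //= sr -invfM -expr2 sqrtCK scale_scalar_mx mulVf ?gt_eqF.
exists (sqrtC b), (Unitary Wu); split=> //=.
  by rewrite scalerA mulfV // scale1r.
by rewrite tensmx1Z -scalemxAl XV -scalemxAr !scalerA mulrC.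
Qed.

End Irreducible.

(** * The stabiliser and effectiveness of the action *)

Section Stabiliser.
Variables (R : realType) (d k : nat).
Local Notation C := (Cplx R).
Implicit Types (V : Virr R d k) (W U : unitary R d) (c : circle R).

(** In dimension zero every trace vanishes, so there is no state. *)
Lemma Virr_dim_gt0 (V : 'M[C]_(d * k, d)) : Virr R d k V -> (0 < d)%N.
Proof.
move=> [_ [rho [[[_ rho1] _ _] _]]]; rewrite lt0n; apply/eqP => d0.
move: rho1; rewrite /mxtrace big1 => [/eqP|i]; first by rewrite eq_sym oner_eq0.
by exfalso; have := leq_ltn_trans (leq0n i) (ltn_ord i); rewrite d0.
Qed.

Lemma act_fixP c W (V : 'M[C]_(d * k, d)) :
  act_mx c W V = V <-> ((W : 'M[C]_d) *t 1%:M) *m V = (c : C) *: (V *m W).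
Proof.
rewrite /act_mx; split=> [H|->].
  rewrite -[in RHS]H -scalemxAl scalerA circle_mulJ scale1r -[RHS]mulmxA.
  by rewrite unitary_Jmul mulmx1.
by rewrite -scalemxAl scalerA mulrC circle_mulJ scale1r -mulmxA unitary_mulJ mulmx1.
Qed.

(** Since [|c| = 1], the eigenvector equation is the equality case of [transfer_eigen_intertwine]
    and gives back the full commutation relation. *)
Lemma stabiliserP V c W :
  stabiliser V (c, \pi_(PU R d) W) <-> channel (val V) W = (c : C) *: (W : 'M[C]_d).
Proof.
have [iso irr] := set_mem (valP V).
transitivity (act_mx c W (val V) = val V).
  by rewrite -val_act; split=> [->//|]; exact: val_inj.
rewrite act_fixP; split=> [H|H].
  by rewrite /channel -mulmxA H -scalemxAr mulmxA iso mul1mx.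
have [W0|W0] := eqVneq (W : 'M[C]_d) 0.
  by rewrite W0 mulmx0 scaler0 tens0mx mul0mx.
have [rho [st _]] := irr.
have [|_ //] := transfer_eigen_intertwine iso st W0 H _.
by rewrite circle_norm.
Qed.

(** If [W] and [U] intertwine [V] with the same phase, the phases cancel and [W^* U] is fixed by the
    channel; it is then a scalar, of modulus one by unitarity. *)
Lemma stabiliser_inj V (g h : gauge_group R d) :
  stabiliser V g -> stabiliser V h -> g.1 = h.1 -> g = h.
Proof.
have Virr_V := set_mem (valP V); have [iso irr] := Virr_V.
have dgt0 := Virr_dim_gt0 Virr_V.
case: g => c; elim/quotW => W; case: h => c'; elim/quotW => U /= gV hV cc'.
move: gV hV; rewrite -cc' /stabiliser /= => /(congr1 val) + /(congr1 val).
rewrite !val_act => /act_fixP WV /act_fixP UV.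
have [a aE] : exists a : C, (W : 'M[C]_d) ^t* *m U = a%:M.
  apply: channel_fixed_scalar Virr_V _.
  rewrite /channel tensmx1M -adjmx_tens1 !mulmxA -adjmxM -mulmxA WV UV adjmxZ adjmxM.
  rewrite -scalemxAl -scalemxAr scalerA mulrC circle_mulJ scale1r.
  by rewrite !mulmxA -(mulmxA ((W : 'M[C]_d) ^t*)) iso mulmx1.
have UE : (U : 'M[C]_d) = a *: (W : 'M[C]_d).
  by rewrite -mul_mx_scalar -aE mulmxA unitary_mulJ mul1mx.
have a1 : `|a| == 1.
  have := unitary_mulJ U; rewrite UE adjmxZ -scalemxAl -scalemxAr scalerA.
  rewrite unitary_mulJ -normCK scale_scalar_mx mulr1.
  move/matrixP/(_ (Ordinal dgt0) (Ordinal dgt0)); rewrite !mxE eqxx !mulr1n.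
  by move/eqP; rewrite sqrf_eq1 => /orP[//|/eqP aN]; move: (normr_ge0 a);
    rewrite aN oppr_ge0 ler10.
by congr (_, _); apply/PU_eqP; exists (Circle a1).
Qed.

(** The matrix acts as ['i] on the range of the projection [P] and as [1] on its kernel. *)
Lemma projector_unitary (P : 'M[C]_d) : P ^t* = P -> P *m P = P ->
  1%:M + ('i - 1) *: P \is unitarymx.
Proof.
move=> Pa PP; apply/unitarymxP; rewrite adjmxD adjmxZ adjmx1 Pa.
rewrite rmorphB /= conjCi conjC1 !mulmxDl !mulmxDr !mul1mx !mulmx1.
rewrite -scalemxAl -scalemxAr PP scalerA -addrA -!scalerDl.
have -> : - 'i - 1 + ('i - 1 + ('i - 1) * (- 'i - 1)) = - 1 - 'i ^+ 2 :> C by ring.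
by rewrite sqrCi opprK addNr scale0r addr0.
Qed.

(** For [n = d] this is the trace of [1 + (i - 1) P] with [P] of trace one; its imaginary part is
    [1]. *)
Lemma i_natr_neq0 (n : nat) : n%:R + ('i - 1) != 0 :> C.
Proof.
apply/eqP => h; have : 'i + 'i = 0 :> C.
  have := congr1 Num.conj h.
  rewrite rmorphD rmorphB /= conjCi conjC_nat conjC1 conjC0 => h'.
  have -> : 'i + 'i = (n%:R + ('i - 1)) - (n%:R + (- 'i - 1)) :> C by ring.
  by rewrite h h' subrr.
by move/eqP; rewrite -mulr2n mulrn_eq0 /= (negbTE (neq0Ci _)).
Qed.

(* The trace is invariant under conjugation and does not vanish on the unitary
   1 + (i - 1) P, so commutation up to a phase is commutation. *)
Lemma phase_commute_projector W (P : 'M[C]_d) :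
  (forall U, exists e : circle R,
     (U : 'M[C]_d) *m (W : 'M[C]_d) = (e : C) *: ((W : 'M[C]_d) *m (U : 'M[C]_d))) ->
  P ^t* = P -> P *m P = P -> \tr P = 1 -> P *m (W : 'M[C]_d) = (W : 'M[C]_d) *m P.
Proof.
move=> H Pa PP P1; have [e] := H (Unitary (projector_unitary Pa PP)) => /= eE.
have e1 : (e : C) = 1.
  have /(congr1 (fun M => \tr ((W : 'M[C]_d) ^t* *m M))) := eE.
  rewrite -scalemxAr mxtraceZ [in RHS]mulmxA unitary_Jmul mul1mx.
  rewrite mxtrace_mulC -mulmxA unitary_mulJ mulmx1.
  rewrite mxtraceD mxtrace1 mxtraceZ P1 mulr1 => /eqP.
  by rewrite -{1}[_ + _]mul1r (inj_eq (mulIf (i_natr_neq0 d))) => /eqP.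
move: eE; rewrite e1 scale1r mulmxDl mulmxDr mul1mx mulmx1 -scalemxAl -scalemxAr.
move/addrI/(congr1 ( *:%R ('i - 1)^-1)); rewrite !scalerA mulVf ?scale1r //.
by have := i_natr_neq0 0; rewrite add0r.
Qed.

(** Commuting with the diagonal matrix units makes [W] diagonal; commuting with the projection [Q]
    onto the constant vectors makes its diagonal entries equal. *)
Lemma phase_commute_scalar W :
  (forall U, exists e : circle R,
     (U : 'M[C]_d) *m (W : 'M[C]_d) = (e : C) *: ((W : 'M[C]_d) *m (U : 'M[C]_d))) ->
  (0 < d)%N -> exists w : C, (W : 'M[C]_d) = w%:M.
Proof.
move=> phaseW dgt0; have H P := @phase_commute_projector W P phaseW.
have Wdiag a b : b != a -> (W : 'M[C]_d) b a = 0.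
  move=> ba.
  have /matrixP/(_ b a) :
      delta_mx a a *m (W : 'M[C]_d) = (W : 'M[C]_d) *m delta_mx a a.
    apply: H.
  - by rewrite trmx_delta; apply/matrixP => i j; rewrite !mxE rmorph_nat.
  - by rewrite mul_delta_mx.
  - rewrite /mxtrace (bigD1 a) //= big1 => [|j /negbTE ja].
      by rewrite mxE !eqxx addr0.
    by rewrite mxE ja.
  have -> : (delta_mx a a *m (W : 'M[C]_d)) b a = 0.
    by rewrite mxE big1 // => j _; rewrite mxE (negbTE ba) mul0r.
  rewrite mxE (bigD1 a) //= mxE !eqxx mulr1 big1 ?addr0 // => j /negbTE ja.
  by rewrite mxE ja mulr0.
have d0 : d%:R != 0 :> C by rewrite pnatr_eq0 -lt0n.
pose Q : 'M[C]_d := const_mx (d%:R^-1).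
exists ((W : 'M[C]_d) (Ordinal dgt0) (Ordinal dgt0)); apply/matrixP => a b.
rewrite mxE; have [<-|ab] := eqVneq a b; last exact: Wdiag.
have /matrixP/(_ a (Ordinal dgt0)) : Q *m (W : 'M[C]_d) = (W : 'M[C]_d) *m Q.
  apply: H.
- by apply/matrixP => i j; rewrite !mxE fmorphV rmorph_nat.
- apply/matrixP => i j; rewrite !mxE; under eq_bigr do rewrite !mxE.
  by rewrite sumr_const card_ord -[LHS]mulr_natl mulrA mulfV // mul1r.
- rewrite /mxtrace; under eq_bigr do rewrite mxE.
  by rewrite sumr_const card_ord -[LHS]mulr_natl mulfV.
rewrite !mxE (bigD1 (Ordinal dgt0)) //= [X in _ + X = _]big1 => [|j j0]; last first.
  by rewrite Wdiag ?mulr0.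
rewrite (bigD1 a) //= [X in _ = _ + X]big1 => [|j ja]; last first.
  by rewrite Wdiag ?mul0r // eq_sym.
by rewrite !mxE !addr0 mulrC => /(mulIf (invr_neq0 d0)) ->; rewrite mulr1n.
Qed.

(** If [g] fixes every point, so does its conjugate by [u = (1, U)], which has the same phase;
    [stabiliser_inj] makes [g] and [u] commute, so [W] commutes with every [U] up to a phase. *)
Lemma effective_Virr : Virr R d k !=set0 -> effective_action R d k.
Proof.
move=> [V0 V0irr]; pose V : Virr R d k := exist _ V0 (mem_set V0irr).
have dgt0 := Virr_dim_gt0 V0irr; pose o := Ordinal dgt0.
apply/seteqP; split=> [g /= gfix|_ -> V' _]; last exact: act1.
case: g gfix => c; elim/quotW => W gfix.
have [w wE] : exists w : C, (W : 'M[C]_d) = w%:M.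
  apply: (phase_commute_scalar _ (dgt0)) => U.
  pose u : gauge_group R d := (1%g, \pi_(PU R d) U).
  pose g : gauge_group R d := (c, \pi_(PU R d) W).
  have ugV : stabiliser V (u^-1 * (g * u))%g.
    by rewrite /stabiliser /= !actM (gfix (act u V) I) -actM mulVg act1.
  have E := stabiliser_inj ugV (gfix V I).
  have {}E : (u^-1 * (g * u))%g = g by apply: E; rewrite /= mulg1 invg1 mul1g.
  have /(congr1 snd) : (g * u)%g = (u * g)%g by rewrite -[in RHS]E mulgA mulgV mul1g.
  by rewrite /= [LHS]PU_mulE [RHS]PU_mulE => /PU_eqP.
have /(stabiliserP V c W) := gfix V I; rewrite wE /channel => H.
have [iso _] := V0irr.
have w1 : `|w| == 1.
  have := unitary_mulJ W; rewrite wE => /matrixP/(_ o o).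
  rewrite tr_scalar_mx map_scalar_mx -scalar_mxM !mxE eqxx !mulr1n -normCK.
  move/eqP; rewrite sqrf_eq1 => /orP[//|/eqP aN]; move: (normr_ge0 w).
  by rewrite aN oppr_ge0 ler10.
have w0 : w != 0 by rewrite -normr_eq0 (eqP w1) oner_eq0.
(* The channel is unital, so the scalar eigenvector [w%:M] has eigenvalue one. *)
have c1 : c = 1%g.
  apply: val_inj => /=; move: H.
  rewrite -[w%:M]scalemx1 tensmx1Z tensmx11 -scalemxAr -scalemxAl mulmx1 [_ *m _]iso.
  rewrite scalerA => /matrixP/(_ o o); rewrite !mxE eqxx !mulr1n !mulr1.
  by move/eqP; rewrite -{1}[w]mul1r (inj_eq (mulIf w0)) => /eqP.
rewrite c1; congr (_, _); apply/esym/PU_eqP; exists (Circle w1).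
by rewrite wE /= scalemx1.
Qed.

End Stabiliser.

(** * Roots of unity and finite multiplicative sets *)

Section RootsOfUnity.
Variable R : realType.
Local Notation C := (Cplx R).

Lemma cisD (x y : R) : (cis (x + y) : C) = (cis x : C) * (cis y : C).
Proof.
rewrite /= cosD sinD; apply/eqP; rewrite eq_complex /=; apply/andP; split=> //.
by rewrite addrC.
Qed.

Lemma cisMn (x : R) n : (cis (x *+ n) : C) = (cis x : C) ^+ n.
Proof.
elim: n => [|n IHn]; last by rewrite mulrS cisD IHn exprS.
by rewrite mulr0n expr0 /= cos0 sin0.
Qed.

(** The real part is [1 - 2 sin (x / 2) ^ 2], and the sine is positive since [x / 2] lies strictly
    between [0] and [pi]. *)
Lemma cis_neq1 (x : R) : 0 < x < pi *+ 2 -> (cis x : C) != 1.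
Proof.
move=> /andP[x0 xpi]; apply/negP => /eqP/(congr1 (@complex.Re R)) /=.
have -> : x = (x / 2) *+ 2 by rewrite -mulr_natr mulfVK ?pnatr_eq0.
have /sin_gt0_pi : 0 < x / 2 < pi.
  by rewrite divr_gt0 //= ltr_pdivrMr // mulr_natr.
move=> s0; rewrite cos_mulr2n cos2sin2 => h.
have : sin (x / 2) ^+ 2 *+ 2 = 0.
  have -> : sin (x / 2) ^+ 2 *+ 2 = 1 - ((1 - sin (x / 2) ^+ 2) *+ 2 - 1) by ring.
  by rewrite h subrr.
by apply/eqP; rewrite mulrn_eq0 /= sqrf_eq0 gt_eqF.
Qed.

Lemma gamma_prim p : (0 < p)%N -> p.-primitive_root (gamma R p : C).
Proof.
move=> p0; rewrite /primitive_root_of_unity p0; apply/forallP => i.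
have pr0 : 0 < p%:R :> R by rewrite ltr0n.
rewrite unity_rootE -cisMn; apply/eqP.
(* The exponent tested is [i.+1]: the value [p] makes a full turn, and smaller ones an angle
   strictly between [0] and [2 pi]. *)
have [->|ip] := eqVneq i.+1 p.
  have -> : (2 * pi / p%:R) *+ p = pi *+ 2 :> R.
    by rewrite -[LHS]mulr_natr mulfVK ?gt_eqF // mulr_natl.
  by rewrite /= cos2pi sin2pi; apply/eqP.
apply/negbTE/cis_neq1; apply/andP; split.
  by rewrite pmulrn_lgt0 // divr_gt0 // mulr_gt0 // pi_gt0.
rewrite -[X in X < _]mulr_natr mulrAC ltr_pdivrMr // mulr_natl.
rewrite ltr_pM2l; last by rewrite pmulrn_lgt0 // pi_gt0.
by rewrite ltr_nat ltn_neqAle ip ltn_ord.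
Qed.

Lemma circle_valX (c : circle R) n : ((c ^+ n)%g : C) = (c : C) ^+ n.
Proof. by elim: n => [|n IHn]; rewrite ?expg0 // expgS exprS /= IHn. Qed.

(* Multiplication by [c] permutes [S], so [c ^+ size S] fixes the product of [S]. *)
Lemma finite_mul_closed_powers (S : seq C) : uniq S -> 1 \in S -> 0 \notin S ->
  {in S &, forall a b, a * b \in S} ->
  forall c, c \in S <-> exists2 j, (j < size S)%N & c = (gamma R (size S) : C) ^+ j.
Proof.
move=> uS S1 S0 SM; have p0 : (0 < size S)%N by case: (S) S1.
have prim := gamma_prim p0.
have SX c : c \in S -> c ^+ size S = 1.
  move=> cS; have c0 : c != 0 by apply: contraNneq S0 => <-.
  have perm : perm_eq [seq c * a | a <- S] S.
    apply: uniq_perm => //; first by rewrite map_inj_uniq //; exact: mulfI.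
    apply: (uniq_min_size _ _ _).2; last by rewrite size_map.
      by rewrite map_inj_uniq //; exact: mulfI.
    by move=> _ /mapP[a aS ->]; exact: SM.
  have : \prod_(i <- [seq c * a | a <- S]) i = \prod_(i <- S) i by exact: perm_big.
  rewrite big_map big_split /= big_const_seq count_predT iter_mulr_1 => /eqP.
  rewrite -{2}[\prod_(i <- S) i]mul1r (inj_eq (mulIf _)) => [/eqP//|].
  by rewrite prodf_seq_neq0; apply/allP => a aS; apply: contraNneq S0 => <-.
have sub c : c \in S -> c \in [seq (gamma R (size S) : C) ^+ j | j <- iota 0 (size S)].
  move=> /SX/(prim_rootP prim)[i ->]; apply/mapP; exists (i : nat) => //.
  by rewrite mem_iota add0n ltn_ord.
(* [S] has no repetition and is as long as the list of powers containing it, so both have the same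
   elements. *)
have [|_ E] := uniq_min_size uS sub; first by rewrite size_map size_iota.
move=> c; rewrite E; split=> [/mapP[j]|[j jp ->]].
  by rewrite mem_iota add0n => jp ->; exists j.
by apply/mapP; exists j; rewrite ?mem_iota.
Qed.

End RootsOfUnity.

(** * Peripheral eigenvalues and the cyclic stabiliser *)

Section Period.
Variables (R : realType) (d k : nat).
Local Notation C := (Cplx R).
Implicit Types (V : 'M[C]_(d * k, d)) (X : 'M[C]_d) (W : unitary R d).

Lemma unitary_neq0 W : (0 < d)%N -> (W : 'M[C]_d) != 0.
Proof.
move=> d0; apply/eqP => W0; have := unitary_mulJ W; rewrite W0 mul0mx.
move/matrixP/(_ (Ordinal d0) (Ordinal d0)); rewrite !mxE eqxx.
by move/eqP; rewrite eq_sym oner_eq0.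
Qed.

Lemma commute_channel V X (a : C) : Defs.isometry V ->
  (X *t 1%:M) *m V = a *: (V *m X) -> channel V X = a *: X.
Proof. by move=> iso H; rewrite /channel -mulmxA H -scalemxAr mulmxA iso mul1mx. Qed.

Lemma unit_eigenvalue_unitary V (a : C) : Virr R d k V -> `|a| = 1 ->
  channel_eigenvalue V a ->
  exists W : unitary R d, ((W : 'M[C]_d) *t 1%:M) *m V = a *: (V *m W).
Proof.
move=> Virr_V a1 [X X0 TX]; have [iso _] := Virr_V.
have [|_ [b [W [_ _ WV]]]] := transfer_eigen_unitary iso Virr_V X0 TX.
  by rewrite a1.
by exists W.
Qed.

(** The list consists of the roots of the characteristic polynomial; it makes the peripheral
    spectrum finite. *)
Lemma linear_eigenvalues (f : {linear 'M[C]_d -> 'M[C]_d}) :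
  exists rs : seq C, forall a X, X != 0 -> f X = a *: X -> a \in rs.
Proof.
have [rs rsE] := closed_field_poly_normal (char_poly (lin_mx f)).
exists rs => a X X0 fX.
have : eigenvalue (lin_mx f) a.
  apply/eigenvalueP; exists (mxvec X); first by rewrite mul_vec_lin fX linearZ.
  by rewrite mxvec_eq0.
rewrite eigenvalue_root_char rsE (monicP (char_poly_monic _)) scale1r.
by rewrite root_prod_XsubC.
Qed.

(** The peripheral spectrum is finite, contains [1] because the channel is unital, and is closed
    under products because unitary eigenvectors multiply: their intertwining relations compose. *)
Lemma period_exists V : Virr R d k V -> exists p, is_period V p.
Proof.
move=> Virr_V; have [iso irr] := Virr_V; have d0 := Virr_dim_gt0 Virr_V.
have [rs rsP] := linear_eigenvalues (transfer V V : {linear _ -> _}).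
pose peripheral (a : C) := `|a| = 1 /\ channel_eigenvalue V a.
pose S := undup [seq a <- rs | `[< peripheral a >]].
have SP a : a \in S <-> peripheral a.
  rewrite mem_undup mem_filter; split=> [/andP[/asboolP]//|aP].
  apply/andP; split; first exact/asboolP.
  by have [_ [X X0 TX]] := aP; exact: rsP X0 TX.
have SE := @finite_mul_closed_powers R S (undup_uniq _).
have S1 : 1 \in S.
  apply/SP; split; first exact: normr1.
  exists 1%:M; first exact: (unitary_neq0 (1%g : unitary R d) d0).
  by rewrite /channel tensmx11 mulmx1 [LHS]iso scale1r.
exists (size S); split; first by case: (S) S1.
move=> a; rewrite -/(peripheral a) -SP; apply: SE => //.
  by apply/negP => /SP[] /eqP; rewrite normr0 eq_sym oner_eq0.
move=> {}a b /SP[a1 aV] /SP[b1 bV]; apply/SP.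
split; first by rewrite normrM a1 b1 mulr1.
have [W WV] := unit_eigenvalue_unitary Virr_V a1 aV.
have [U UV] := unit_eigenvalue_unitary Virr_V b1 bV.
exists (W * U)%g; first exact: unitary_neq0.
apply: commute_channel => //=.
rewrite tensmx1M -mulmxA UV -scalemxAr [in LHS]mulmxA WV -scalemxAl scalerA mulmxA.
by rewrite mulrC.
Qed.

Lemma period_Z_exists V : Virr R d k V ->
  exists p (Z : unitary R d), is_period V p /\ is_Z V p Z.
Proof.
move=> Virr_V; have [p pV] := period_exists Virr_V; have [p0 pP] := pV.
have [g1 gV] : `|gamma R p : C| = 1 /\ channel_eigenvalue V (gamma R p).
  (* Reducing the exponent modulo [p] covers [p = 1], where only the exponent [0] is allowed. *)
  apply/pP; exists (1 %% p)%N; first by rewrite ltn_mod.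
  by rewrite (prim_expr_mod (gamma_prim R p0)) expr1.
have [Z ZV] := unit_eigenvalue_unitary Virr_V g1 gV.
have [iso _] := Virr_V.
by exists p, Z; split=> //; exact: commute_channel.
Qed.

Lemma pair_expg (G H : groupType) (x : G) (y : H) n :
  ((x, y) ^+ n)%g = (x ^+ n, y ^+ n)%g.
Proof. by elim: n => [//|n IHn]; rewrite !expgS IHn. Qed.

Lemma stabiliserX (V : Virr R d k) g n : stabiliser V g -> stabiliser V (g ^+ n)%g.
Proof.
rewrite /stabiliser /= => gV; elim: n => [|n IHn]; first exact: act1.
by rewrite expgS actM IHn.
Qed.

Section Cyclic.
Variables (V : Virr R d k) (p : nat) (Z : unitary R d).
Hypotheses (pV : is_period (val V) p) (ZV : is_Z (val V) p Z).

Let g : gauge_group R d := (gamma R p, \pi_(PU R d) Z).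

Lemma stabiliser_gZ : stabiliser V g. Proof. exact/stabiliserP. Qed.

(** The phase of a stabilising element is a peripheral eigenvalue, hence a power of [gamma R p], and
    by [stabiliser_inj] the phase determines the element. *)
Lemma stabiliser_powers : stabiliser V = [set (g ^+ j)%g | j in `I_p].
Proof.
have [_ pP] := pV.
apply/seteqP; split=> [h hV|_ [j _ <-]]; last exact/stabiliserX/stabiliser_gZ.
have [j jp hj] : exists2 j, (j < p)%N & (h.1 : C) = (gamma R p : C) ^+ j.
  apply/pP; split; first exact: circle_norm.
  case: h hV => c; elim/quotW => W /stabiliserP WV.
  exists W => //; apply: unitary_neq0; apply: Virr_dim_gt0.
  exact: set_mem (valP V).
exists j => //; apply: (stabiliser_inj (stabiliserX _ stabiliser_gZ) hV).
by rewrite pair_expg; apply: val_inj; rewrite /= circle_valX.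
Qed.

(** Everything is read off the phases, powers of a primitive root of unity; [stabiliser_inj] lifts
    the identities to the group. *)
Lemma stabiliser_cyclic : isog_Zmod (stabiliser V) p.
Proof.
have [p0 _] := pV; have prim := gamma_prim R p0.
have gX1 n : ((g ^+ n)%g.1 : C) = (gamma R p : C) ^+ n.
  by rewrite pair_expg circle_valX.
exists (fun i : 'I_p => g ^+ i)%g; split.
- move=> i j /(congr1 (fun h : gauge_group R d => (h.1 : C))); rewrite !gX1 => /eqP.
  by rewrite (eq_prim_root_expr prim) !modn_small // => /eqP/val_inj.
- rewrite stabiliser_powers; apply/seteqP; split=> [_ [i _ <-]|_ [i ip <-]].
    by exists (i : nat) => //=; exact: ltn_ord.
  by exists (Ordinal ip).
- move=> i j l lE; rewrite -expgnDr.
  apply: (@stabiliser_inj _ _ _ V); try exact/stabiliserX/stabiliser_gZ.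
  apply: val_inj; apply: etrans (gX1 _) _; apply: etrans (esym (gX1 _)).
  by apply/eqP; rewrite (eq_prim_root_expr prim) lE.
Qed.

Lemma stabiliser_finite : finite_set (stabiliser V).
Proof. by rewrite stabiliser_powers; apply: finite_image; exact: finite_II. Qed.

End Cyclic.

End Period.

(** * Geometric decay of iterates from the spectrum *)

Section Decay.
Variable C : numClosedFieldType.

(** At [n = 0] the bound forces [K] to be real and nonnegative. *)
Definition decays (q : C) (s : nat -> C) :=
  exists K : C, forall n, `|s n| <= K * q ^+ n.

Lemma eq_decays q s t : s =1 t -> decays q s -> decays q t.
Proof. by move=> st [K sK]; exists K => n; rewrite -st. Qed.

Lemma decays0 q : decays q (fun=> 0).
Proof. by exists 0 => n; rewrite normr0 mul0r. Qed.

Lemma decaysD q s t : decays q s -> decays q t -> decays q (fun n => s n + t n).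
Proof.
move=> [K sK] [L tL]; exists (K + L) => n.
by rewrite mulrDl (le_trans (ler_normD _ _)) // lerD.
Qed.

Lemma decaysZ q (a : C) s : decays q s -> decays q (fun n => a * s n).
Proof. by move=> [K sK]; exists (`|a| * K) => n; rewrite normrM -mulrA ler_wpM2l. Qed.

Lemma decays_norm q s : decays q s -> decays q (fun n => `|s n|).
Proof. by move=> [K sK]; exists K => n; rewrite normr_id. Qed.

Lemma decays_sum q (I : Type) (r : seq I) (s : I -> nat -> C) :
  (forall i, decays q (s i)) -> decays q (fun n => \sum_(i <- r) s i n).
Proof.
move=> sq; elim: r => [|i r IHr].
  by apply: eq_decays (decays0 q) => n; rewrite big_nil.
by apply: eq_decays (decaysD (sq i) IHr) => n; rewrite big_cons.
Qed.

Lemma decays_recurrence q (z : C) s t : `|z| < q ->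
  (forall n, s n.+1 = z * s n + t n) -> decays q t -> decays q s.
Proof.
move=> zq sE [K tK]; have q0 : 0 <= q by rewrite (le_trans _ (ltW zq)).
have qz : 0 < q - `|z| by rewrite subr_gt0.
have K0 : 0 <= K by have := tK 0%N; rewrite expr0 mulr1; apply: le_trans.
(* Any constant [M >= |s 0|] with [K <= (q - |z|) M] passes through the induction, as
   [|z| M + K <= q M]. *)
exists (`|s 0%N| + K / (q - `|z|)); elim=> [|n IHn].
  by rewrite expr0 mulr1 lerDl divr_ge0 // ltW.
rewrite sE (le_trans (ler_normD _ _)) // normrM.
apply: le_trans (lerD (ler_wpM2l (normr_ge0 z) IHn) (tK n)) _.
rewrite mulrA -mulrDl exprS mulrA ler_wpM2r ?exprn_ge0 //.
rewrite -subr_ge0.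
have -> : (`|s 0%N| + K / (q - `|z|)) * q - (`|z| * (`|s 0%N| + K / (q - `|z|)) + K) =
    `|s 0%N| * (q - `|z|) + (K / (q - `|z|) * (q - `|z|) - K) by ring.
by rewrite mulfVK ?gt_eqF // subrr addr0 mulr_ge0 // ltW.
Qed.

Lemma uniform_bound_lt1 (rs : seq C) : (forall z, z \in rs -> `|z| < 1) ->
  exists q : C, [/\ 0 <= q, q < 1 & forall z, z \in rs -> `|z| < q].
Proof.
elim: rs => [|z rs IHrs] zrs; first by exists 0.
have [|q [q0 q1 qrs]] := IHrs; first by move=> y yrs; rewrite zrs // inE yrs orbT.
have z1 : `|z| < 1 by rewrite zrs // inE eqxx.
have h0 : 0 < 2 :> C by rewrite ltr0n.
have zm : `|z| < (`|z| + 1) / 2.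
  by rewrite ltr_pdivlMr // mulr_natr mulr2n ltrD2l.
have m1 : (`|z| + 1) / 2 < 1 by rewrite ltr_pdivrMr // mul1r [ltRHS]mulr2n ltrD2r.
have m0 : 0 <= (`|z| + 1) / 2 by rewrite (le_trans _ (ltW zm)).
have [qm|mq] := real_leP (ger0_real q0) (ger0_real m0).
  exists ((`|z| + 1) / 2); split=> // y; rewrite inE => /orP[/eqP-> //|/qrs yq].
  exact: lt_le_trans yq qm.
exists q; split=> // y; rewrite inE => /orP[/eqP->|/qrs//].
exact: lt_trans zm mq.
Qed.

(** Induction on the factors: [v (A - z)] is annihilated by the remaining ones, and its orbit is the
    inhomogeneous term of the first-order recurrence satisfied by the orbit of [v]. *)
Lemma horner_annihilated_decays N (A : 'M[C]_N.+1) (q : C) (rs : seq C)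
    (v : 'rV[C]_N.+1) j :
  (forall z, z \in rs -> `|z| < q) ->
  v *m horner_mx A (\prod_(z <- rs) ('X - z%:P)) = 0 ->
  decays q (fun n => (v *m A ^+ n) 0 j).
Proof.
elim: rs v => [|z rs IHrs] v rsq.
  rewrite big_nil rmorph1 mulmx1 => ->.
  by apply: eq_decays (decays0 q) => n; rewrite mul0mx mxE.
rewrite big_cons rmorphM rmorphB /= horner_mx_X horner_mx_C -mulmxE mulmxA => v0.
have zq : `|z| < q by rewrite rsq // inE eqxx.
apply: (decays_recurrence zq) (IHrs _ _ v0) => [n|y yrs]; last first.
  by rewrite rsq // inE yrs orbT.
rewrite mulmxBr mulmxBl mul_mx_scalar -scalemxAl exprS -mulmxE mulmxA.
by move: (v *m A *m A ^+ n) (v *m A ^+ n) => a b; rewrite !mxE addrCA subrr addr0.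
Qed.

(** By Cayley-Hamilton the characteristic polynomial annihilates every [v], and its finitely many
    roots have modulus below a common [q < 1]. *)
Lemma eigenvalues_lt1_decays N (A : 'M[C]_N) :
  (forall (a : C) (v : 'rV[C]_N), v != 0 -> v *m A = a *: v -> `|a| < 1) ->
  exists2 q : C, 0 <= q < 1 &
    forall (v : 'rV[C]_N) j, decays q (fun n => iter n (mulmxr A) v 0 j).
Proof.
case: N A => [|N] A H; first by exists 0; [rewrite lexx ltr01|move=> v []].
have [rs rsE] := closed_field_poly_normal (char_poly A).
rewrite (monicP (char_poly_monic _)) scale1r in rsE.
have [z zrs|q [q0 q1 rsq]] := @uniform_bound_lt1 rs.
  have : eigenvalue A z by rewrite eigenvalue_root_char rsE root_prod_XsubC.
  by move=> /eigenvalueP[v vA v0]; exact: H v0 vA.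
exists q; first by rewrite q0.
move=> v j; have vA n : iter n (mulmxr A) v = v *m A ^+ n.
  elim: n => [|n IHn]; first by rewrite expr0 mulmx1.
  by rewrite iterS IHn exprSr -mulmxE mulmxA.
apply: (@eq_decays q (fun n => (v *m A ^+ n) 0 j)) => [n|]; first by rewrite vA.
by apply: (horner_annihilated_decays _ rsq); rewrite -rsE Cayley_Hamilton mulmx0.
Qed.

Lemma linear_eigenvalues_lt1_decays d (f : {linear 'M[C]_d -> 'M[C]_d}) :
  (forall (a : C) X, X != 0 -> f X = a *: X -> `|a| < 1) ->
  exists2 q : C, 0 <= q < 1 &
    forall X i j, decays q (fun n => iter n f X i j).
Proof.
move=> H; have [a v v0 vE|q q01 dec] := @eigenvalues_lt1_decays _ (lin_mx f).
  apply: (H a (vec_mx v)); first by rewrite vec_mx_eq0.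
  by apply: (can_inj mxvecK); rewrite -mul_vec_lin vec_mxK vE linearZ /= vec_mxK.
exists q => // X i j.
apply: eq_decays (dec (mxvec X) (mxvec_index i j)) => n.
suff -> : iter n (mulmxr (lin_mx f)) (mxvec X) = mxvec (iter n f X).
  by rewrite mxvecE.
by elim: n => [//|n IHn]; rewrite !iterS IHn /= mul_vec_lin.
Qed.

End Decay.

Lemma decays_small (R : realType) (q e : Cplx R) (s : nat -> Cplx R) :
  decays q s -> 0 <= q < 1 -> 0 < e -> exists n, `|s n| < e.
Proof.
move=> [K sK] /andP[q0 q1] e0.
have K0 : 0 <= K by have := sK 0%N; rewrite expr0 mulr1; apply: le_trans.
(* [q], [K] and [e] are nonnegative, hence real, and the limit of the geometric sequence is taken on
   their real parts. *)
have qE := RRe_real (ger0_real q0); have KE := RRe_real (ger0_real K0).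
have eE := RRe_real (ger0_real (ltW e0)).
set x := complex.Re q in qE; set k := complex.Re K in KE.
set y := complex.Re e in eE.
have x1 : `|x| < 1 by rewrite ger0_norm -?ltcR -?ler0c qE.
have y0 : 0 < y by rewrite -ltcR eE.
have k0 : 0 <= k by rewrite -ler0c KE.
have k1 : 0 < k + 1 by rewrite ltr_wpDl.
(* The denominator [k + 1] stays positive when [k = 0]. *)
have yk : 0 < y / (k + 1) by rewrite divr_gt0.
have /cvgr0_norm_lt/(_ _ yk)[n _ /(_ n (leqnn n))] := cvg_expr x1.
rewrite /= ger0_norm ?exprn_ge0 -?ler0c ?qE // ltr_pdivlMr // => xn.
exists n; apply: le_lt_trans (sK n) _.
rewrite -eE -KE -qE -rmorphXn -rmorphM ltcR.
apply: le_lt_trans xn; rewrite mulrC ler_wpM2l ?lerDl ?ler01 //.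
by rewrite exprn_ge0 // -ler0c qE.
Qed.

(** * Overlap of two factorisations of one state *)

Section Gram.
Variable C : numClosedFieldType.

Lemma adjmxE m n (A : 'M[C]_(m, n)) i j : (A ^t*) i j = (A j i)^*.
Proof. by rewrite !mxE. Qed.

Lemma mulmx_delta_mulmx m n p q (P : 'M[C]_(m, n)) (Q : 'M[C]_(p, q)) a a' b b' :
  (P *m delta_mx a a' *m Q) b b' = P b a * Q a' b'.
Proof.
rewrite mxE (bigD1 a') //= big1 => [|j /negbTE ja]; last first.
  rewrite mxE big1 ?mul0r // => l _.
  by rewrite mxE ja andbF mulr0.
rewrite addr0; congr (_ * _); rewrite mxE (bigD1 a) //= big1 => [|j /negbTE ja].
  by rewrite addr0 mxE !eqxx mulr1.
by rewrite mxE ja mulr0.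
Qed.

Lemma mxtrace_adj_mul m n (A : 'M[C]_(m, n)) :
  \tr (A ^t* *m A) = \sum_j \sum_i `|A i j| ^+ 2.
Proof.
apply: eq_bigr => j _; rewrite mxE; apply: eq_bigr => i _.
by rewrite !mxE mulrC -normCK.
Qed.

Lemma sum_sqr_le_sqr_sum (I : finType) (x : I -> C) : (forall i, 0 <= x i) ->
  \sum_i x i ^+ 2 <= (\sum_i x i) ^+ 2.
Proof.
move=> x0; rewrite [leRHS]expr2 mulr_suml; apply: ler_sum => i _.
by rewrite expr2 ler_wpM2l // (bigD1 i) //= lerDl sumr_ge0.
Qed.

Definition entrywise_norm m n (A : 'M[C]_(m, n)) := \sum_j \sum_i `|A i j|.

(* [tr (B^* B)^2 = tr (A^* B)^* (A^* B)] because [A A^* = B B^*]. *)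
Lemma gram_overlap m n (A B : 'M[C]_(m, n)) : A *m A ^t* = B *m B ^t* ->
  \tr (B *m B ^t*) = 1 -> 1 <= n%:R * entrywise_norm (A ^t* *m B).
Proof.
move=> AB B1; set s := entrywise_norm _.
have s0 : 0 <= s by do 2!apply: sumr_ge0 => ? _.
pose M := B ^t* *m B.
have Ms : \sum_j \sum_i `|M i j| ^+ 2 <= s ^+ 2.
  rewrite -mxtrace_adj_mul /M adjmxM trmxCK !mulmxA -(mulmxA (B ^t*) B) -AB.
  have -> : B ^t* *m (A *m A ^t*) *m B = (A ^t* *m B) ^t* *m (A ^t* *m B).
    by rewrite adjmxM trmxCK !mulmxA.
  rewrite mxtrace_adj_mul /s /entrywise_norm !pair_bigA /=.
  exact: (sum_sqr_le_sqr_sum (fun p => normr_ge0 ((A ^t* *m B) p.2 p.1))).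
have Mj j : `|M j j| <= s.
  rewrite -(@ler_pXn2r _ 2) ?nnegrE // (le_trans _ Ms) //.
  rewrite (bigD1 j) //= (bigD1 j) //= -addrA lerDl; apply: addr_ge0.
    by apply: sumr_ge0 => i _; rewrite exprn_ge0.
  by apply: sumr_ge0 => i _; apply: sumr_ge0 => l _; rewrite exprn_ge0.
have M1 : \tr M = 1 by rewrite mxtrace_mulC.
(* The trace of [M] has [n] terms of modulus at most [s]: only the number of columns enters the
   bound. *)
rewrite -[leLHS]normr1 -[X in `|X|]M1.
apply: le_trans (ler_norm_sum _ _ _) _.
apply: le_trans (ler_sum _ (fun j _ => Mj j)) _.
by rewrite sumr_const card_ord mulr_natl.
Qed.

End Gram.

(** * Spectral factorisation of positive semidefinite matrices *)

Section GramFactor.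
Variable R : realType.
Local Notation C := (Cplx R).

(** [A - A^*] is anti-Hermitian, hence unitarily diagonalisable; its eigenvalues are differences
    between values of the form [A], which are real, and their conjugates. *)
Lemma pdmx_hermitian n (A : 'M[C]_n) : psdmx A -> A ^t* = A.
Proof.
move=> A0; apply/eqP; rewrite eq_sym -subr_eq0; apply/eqP; set B := A - A ^t*.
have Ba : B ^t* = - B.
  by rewrite /B; apply/matrixP => i j; rewrite !mxE rmorphB /= conjCK opprB.
have : B \is normalmx by apply/normalmxP; rewrite Ba mulmxN mulNmx.
move=> /orthomx_spectralP; set P := spectralmx B; set D := spectral_diag B.
have Pu : P \is unitarymx := spectral_unitarymx B.
rewrite invmx_unitary // => BE.
suff D0 : D = 0 by rewrite BE D0 raddf0 mulmx0 mul0mx.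
have PBP : P *m B *m P ^t* = diag_mx D.
  rewrite [X in P *m X]BE !mulmxA (unitarymxP Pu) mul1mx -mulmxA.
  by rewrite (unitarymxP Pu) mulmx1.
apply/rowP => i; rewrite [RHS]mxE.
have -> : D 0 i = (P *m B *m P ^t*) i i by rewrite PBP mxE eqxx mulr1n.
have -> : P *m B *m P ^t* = P *m A *m P ^t* - (P *m A *m P ^t*) ^t*.
  by rewrite !adjmxM trmxCK mulmxBr mulmxBl !mulmxA.
have /ger0_real/CrealP := psdmx_sandwich_ge0 P i A0.
by move: (P *m A *m P ^t*) => M; rewrite !mxE => ->; rewrite subrr.
Qed.

(** In an orthonormal eigenbasis the diagonal entries are values of the form [A], so they are
    nonnegative and have real square roots. *)
Lemma psdmx_gram n (A : 'M[C]_n) : psdmx A -> exists S : 'M[C]_n, A = S *m S ^t*.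
Proof.
move=> A0; have Aherm := pdmx_hermitian A0.
have : A \is normalmx by apply/normalmxP; rewrite Aherm.
move=> /orthomx_spectralP; set P := spectralmx A; set D := spectral_diag A.
have Pu : P \is unitarymx := spectral_unitarymx A.
rewrite invmx_unitary // => AE.
have D0 i : 0 <= D 0 i.
  have := psdmx_sandwich_ge0 P i A0; rewrite [X in P *m X]AE.
  rewrite !mulmxA (unitarymxP Pu) mul1mx -mulmxA (unitarymxP Pu) mulmx1.
  by rewrite mxE eqxx mulr1n.
exists (P ^t* *m diag_mx (map_mx sqrtC D)).
rewrite adjmxM trmxCK [LHS]AE !mulmxA; congr (_ *m _); rewrite -!mulmxA.
congr (_ *m _); rewrite tr_diag_mx map_diag_mx mulmx_diag; congr diag_mx.
apply/matrixP => i j; rewrite !mxE ord1.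
have /CrealP sr : sqrtC (D 0 j) \is Num.real by rewrite ger0_real // sqrtC_ge0.
by rewrite [X in _ * X]sr -expr2 sqrtCK.
Qed.

End GramFactor.

(** * Output states through words of Kraus operators *)

Section Output.
Variables (R : realType) (d k : nat).
Local Notation C := (Cplx R).
Implicit Types (V : 'M[C]_(d * k, d)) (X rho S : 'M[C]_d).

Lemma kraus_mull V X i : kraus ((X *t 1%:M) *m V) i = X *m kraus V i.
Proof.
apply/matrixP => a b; rewrite !mxE.
under [RHS]eq_bigr do rewrite mxE.
rewrite -(sum_tens1 (fun x => V x b) (X a) i).
by apply: eq_bigr => x _; rewrite !mxE mxtens_indexK.
Qed.

Lemma kraus_mulr V X i : kraus (V *m X) i = kraus V i *m X.
Proof. by apply/matrixP => a b; rewrite !mxE; apply: eq_bigr => j _; rewrite mxE. Qed.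

Lemma krausZ (c : C) V i : kraus (c *: V) i = c *: kraus V i.
Proof. by apply/matrixP => a b; rewrite !mxE. Qed.

Lemma sum_mxtens m n (F : 'I_(m * n) -> C) :
  \sum_x F x = \sum_i \sum_a F (mxtens_index (a, i)).
Proof.
rewrite exchange_big pair_big /= (reindex (@mxtens_index m n)) /=; last first.
  by exists (@mxtens_unindex m n) => x _; rewrite (mxtens_indexK, mxtens_unindexK).
by apply: eq_bigr => -[].
Qed.

Lemma adjmx_mul_kraus V1 V2 :
  V1 ^t* *m V2 = \sum_i (kraus V1 i) ^t* *m kraus V2 i.
Proof.
apply/matrixP => a b; rewrite summxE mxE sum_mxtens; apply: eq_bigr => i _.
by rewrite mxE; apply: eq_bigr => j _; rewrite !mxE.
Qed.

Lemma transfer_kraus V1 V2 X :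
  transfer V1 V2 X = \sum_i (kraus V1 i) ^t* *m X *m kraus V2 i.
Proof.
rewrite /transfer -mulmxA adjmx_mul_kraus; apply: eq_bigr => i _.
by rewrite kraus_mull mulmxA.
Qed.

Lemma kraus_word_cons V i w : kraus_word V (i :: w) = kraus_word V w *m kraus V i.
Proof.
rewrite /kraus_word /= mulmx1.
suff H (A B : 'M[C]_d) : foldl (fun A i => kraus V i *m A) (A *m B) w =
    foldl (fun A i => kraus V i *m A) A w *m B by rewrite -H mul1mx.
by elim: w A => [//|l w IHw] A /=; rewrite mulmxA IHw.
Qed.

Lemma big_tuple_cons n (M : nmodType) (F : n.+1.-tuple 'I_k -> M) :
  \sum_w F w = \sum_i \sum_(w : n.-tuple 'I_k) F [tuple of i :: w].
Proof.
rewrite pair_big /= (reindex (fun p : 'I_k * n.-tuple 'I_k => [tuple of p.1 :: p.2])) //.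
exists (fun w => (thead w, [tuple of behead w])) => [[i w] _|w _] /=.
  by congr (_, _); apply: val_inj.
by rewrite [RHS]tuple_eta.
Qed.

(** The outer application of the map contributes the outermost Kraus factors, those of the first
    letter, so the induction splits words at their head. *)
Lemma iter_transfer V1 V2 n X : iter n (transfer V1 V2) X =
  \sum_(w : n.-tuple 'I_k) (kraus_word V1 w) ^t* *m X *m kraus_word V2 w.
Proof.
elim: n => [|n IHn].
  rewrite (big_pred1 [tuple]) => [|w]; last by apply/esym/eqP; rewrite [w]tuple0.
  by rewrite /kraus_word /= adjmx1 mul1mx mulmx1.
rewrite iterS IHn transfer_kraus big_tuple_cons; apply: eq_bigr => i _.
rewrite mulmx_sumr mulmx_suml; apply: eq_bigr => w _.
by rewrite !kraus_word_cons adjmxM !mulmxA.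
Qed.

(* With [rho = S S^*] the output state is [A A^*] for [A = output_amplitude V S n],
   which has only [d^2] columns whatever [n]. *)
Definition output_amplitude V S n : 'M[C]_(#|{: n.-tuple 'I_k}|, d * d) :=
  \matrix_(x, y) (kraus_word V (enum_val x : n.-tuple 'I_k) *m S)
                   (mxtens_unindex y).1 (mxtens_unindex y).2.

Lemma output_amplitudeE V S n x a b : output_amplitude V S n x (mxtens_index (a, b)) =
  (kraus_word V (enum_val x : n.-tuple 'I_k) *m S) a b.
Proof. by rewrite mxE mxtens_indexK. Qed.

Lemma rho_outE V n x y : rho_out V n x y =
  \tr (kraus_word V (enum_val x : n.-tuple 'I_k) *m rho_ss V
         *m (kraus_word V (enum_val y : n.-tuple 'I_k)) ^t*).
Proof.
rewrite mxE; apply: eq_bigr => a _; rewrite !mxE; apply: eq_bigr => j _.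
rewrite !mxE mxtens_indexK; congr (_ * _).
by apply: eq_bigr => i _; rewrite mxE mxtens_indexK.
Qed.

Lemma rho_out_gram V S n : rho_ss V = S *m S ^t* ->
  rho_out V n = output_amplitude V S n *m (output_amplitude V S n) ^t*.
Proof.
move=> VS; apply/matrixP => x y; rewrite rho_outE VS mulmxA -mulmxA -adjmxM.
rewrite [RHS]mxE sum_mxtens exchange_big; apply: eq_bigr => a _.
rewrite mxE; apply: eq_bigr => b _.
by rewrite !adjmxE !output_amplitudeE.
Qed.

Lemma sum_enum_tuple n (F : n.-tuple 'I_k -> C) :
  \sum_(x < #|{: n.-tuple 'I_k}|) F (enum_val x) = \sum_w F w.
Proof.
rewrite (reindex (@enum_val _ {: n.-tuple 'I_k})) //=.
by exists enum_rank => x _; rewrite (enum_rankK, enum_valK).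
Qed.

(** The matrix unit glues row [a] of one amplitude to row [a'] of the other; summing over words
    turns the overlap into an iterate of the transfer map, which is what decay controls. *)
Lemma output_amplitude_overlap V1 V2 S1 S2 n a b a' b' :
  ((output_amplitude V1 S1 n) ^t* *m output_amplitude V2 S2 n)
     (mxtens_index (a, b)) (mxtens_index (a', b')) =
  (S1 ^t* *m iter n (transfer V1 V2) (delta_mx a a') *m S2) b b'.
Proof.
rewrite iter_transfer mulmx_sumr mulmx_suml summxE mxE.
rewrite -(sum_enum_tuple (fun w => (S1 ^t* *m ((kraus_word V1 w) ^t* *m
  delta_mx a a' *m kraus_word V2 w) *m S2) b b')).
apply: eq_bigr => x _; set w := enum_val x.
rewrite adjmxE !output_amplitudeE !mulmxA -adjmxM -mulmxA.
by rewrite mulmx_delta_mulmx adjmxE.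
Qed.

Lemma rho_ss_stationary V : Virr R d k V -> stationary_state V (rho_ss V).
Proof.
move=> [_ [rho [st _]]].
by apply: (@xgetPex _ 0 [set rho | stationary_state V rho]); exists rho.
Qed.

(** The trace is that of [rho_ss V] times an iterate of the channel at the identity, which unitality
    leaves unchanged. *)
Lemma rho_out_trace V n : Virr R d k V -> \tr (rho_out V n) = 1.
Proof.
move=> Virr_V; have [iso _] := Virr_V.
have [[_ rho1] _ rhoV] := rho_ss_stationary Virr_V.
rewrite /mxtrace; under eq_bigr do rewrite rho_outE.
rewrite (sum_enum_tuple
  (fun w => \tr (kraus_word V w *m rho_ss V *m (kraus_word V w) ^t*))).
have <- : \tr (rho_ss V *m iter n (transfer V V) 1%:M) = 1.
  rewrite (_ : iter n _ _ = 1%:M) ?mulmx1 //.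
  by elim: n => [//|n IHn]; rewrite iterS IHn /transfer tensmx11 mulmx1.
rewrite iter_transfer mulmx_sumr raddf_sum; apply: eq_bigr => w _ /=.
by rewrite mxtrace_sandwich mulmx1.
Qed.

End Output.

(** * Output equivalence and the quotient spaces *)

Section OutputEquivalence.
Variables (R : realType) (d k : nat).
Local Notation C := (Cplx R).
Implicit Types (V : 'M[C]_(d * k, d)) (c : circle R) (W : unitary R d).

Lemma kraus_act c W V i :
  kraus (act_mx c W V) i = (c : C)^* *: ((W : 'M[C]_d) *m kraus V i *m (W : 'M[C]_d) ^t*).
Proof. by rewrite /act_mx krausZ kraus_mulr kraus_mull. Qed.

Lemma kraus_word_act c W V w : kraus_word (act_mx c W V) w =
  (c : C)^* ^+ size w *: ((W : 'M[C]_d) *m kraus_word V w *m (W : 'M[C]_d) ^t*).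
Proof.
elim: w => [|i w IHw].
  by rewrite /kraus_word /= expr0 scale1r mulmx1 unitary_mulJ.
rewrite !kraus_word_cons IHw kraus_act -scalemxAl -scalemxAr scalerA -exprSr.
congr (_ *: _); rewrite !mulmxA; congr (_ *m _ *m _).
by rewrite -[_ *m _ ^t* *m (W : 'M[C]_d)]mulmxA unitary_Jmul mulmx1.
Qed.

Lemma rho_ss_act c W V : Virr R d k V ->
  rho_ss (act_mx c W V) = (W : 'M[C]_d) *m rho_ss V *m (W : 'M[C]_d) ^t*.
Proof.
move=> Virr_V; have [_ [rho [_ uniq]]] := Virr_act c W Virr_V.
rewrite -(uniq _ (rho_ss_stationary (Virr_act c W Virr_V))).
exact/uniq/stationary_act/rho_ss_stationary.
Qed.

(** Both words have length [n], so their phases cancel; the unitaries cancel inside the product and,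
    by cyclicity of the trace, at its ends. *)
Lemma rho_out_act c W V n : Virr R d k V -> rho_out (act_mx c W V) n = rho_out V n.
Proof.
move=> Virr_V; apply/matrixP => x y.
apply: etrans (rho_outE _ _ _) _; apply: etrans _ (esym (rho_outE _ _ _)).
rewrite (rho_ss_act c W Virr_V) 2!(kraus_word_act c W V) !size_tuple.
move: (kraus_word V _) (kraus_word V _) (rho_ss V) => A B rho.
rewrite adjmxZ -!scalemxAl -scalemxAr scalerA -normCK normrX norm_conjC circle_norm.
rewrite !expr1n scale1r !adjmxM trmxCK !mulmxA.
do 2!rewrite -[_ *m _ ^t* *m (W : 'M[C]_d)]mulmxA unitary_Jmul mulmx1.
by rewrite mxtrace_mulC !mulmxA unitary_Jmul mul1mx.
Qed.

Lemma decays_mulmx m n p q (z : C) (P : 'M[C]_(m, n)) (M : nat -> 'M[C]_(n, p))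
    (Q : 'M[C]_(p, q)) i j :
  (forall a b, decays z (fun l => M l a b)) ->
  decays z (fun l => (P *m M l *m Q) i j).
Proof.
move=> Mz; apply: (@eq_decays _ _
  (fun l => \sum_b Q b j * \sum_a P i a * M l a b)) => [l|].
  by rewrite [RHS]mxE; apply: eq_bigr => b _; rewrite mulrC mxE.
by do 2!(apply: decays_sum => ?; apply: decaysZ).
Qed.

Lemma equal_output_eigenvalue V1 V2 : Virr R d k V1 -> Virr R d k V2 ->
  (forall n, rho_out V1 n = rho_out V2 n) ->
  exists a : C, exists2 X, X != 0 & transfer V1 V2 X = a *: X /\ 1 <= `|a|.
Proof.
move=> V1irr V2irr outE; apply: contrapT => noeig.
have [a X X0 TX|z z01 dec] := @linear_eigenvalues_lt1_decays _ _
    (transfer V1 V2 : {linear _ -> _}).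
  rewrite real_ltNge ?normr_real ?real1 //; apply/negP => a1.
  by apply: noeig; exists a, X.
have psd V : Virr R d k V -> psdmx (rho_ss V).
  by move=> /rho_ss_stationary[[]].
have [S1 S1E] := psdmx_gram (psd _ V1irr).
have [S2 S2E] := psdmx_gram (psd _ V2irr).
pose overlap n := (output_amplitude V1 S1 n) ^t* *m output_amplitude V2 S2 n.
(* Both amplitudes factor the same state of trace one and have [d * d] columns for every [n], so the
   lower bound is uniform in [n]. *)
have bound n : 1 <= (d * d)%:R * entrywise_norm (overlap n).
  apply: gram_overlap; first by rewrite -!rho_out_gram.
  by rewrite -rho_out_gram // rho_out_trace.
have : decays z (fun n => (d * d)%:R * entrywise_norm (overlap n)).
  apply: decaysZ; apply: decays_sum => j; apply: decays_sum => i; apply: decays_norm.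
  rewrite /overlap; case: (mxtens_indexP i) => a b; case: (mxtens_indexP j) => a' b'.
  have := @decays_mulmx _ _ _ _ z (S1 ^t*) _ S2 b b' (dec (delta_mx a a')).
  by apply: eq_decays => n; rewrite output_amplitude_overlap.
move=> /decays_small/(_ z01 ltr01)[n]; apply/negP; rewrite -real_leNgt //.
by rewrite (le_trans (bound n)) // real_ler_norm // ger0_real // (le_trans ler01).
Qed.

Lemma output_equivalentP (V1 V2 : Virr R d k) :
  output_equivalent V1 V2 <-> same_orbit V1 V2.
Proof.
have V1irr := set_mem (valP V1); have V2irr := set_mem (valP V2).
split=> [/asboolP outE|/asboolP[[c]]]; last first.
  elim/quotW => W ->; apply/asboolP => n; by rewrite val_act rho_out_act.
have [a [X X0 [TX a1]]] := equal_output_eigenvalue V1irr V2irr outE.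
have [iso1 _] := V1irr.
have [/eqP a1' [b [W [_ _ WV]]]] := transfer_eigen_unitary iso1 V2irr X0 TX a1.
(* The eigenvector yields an element carrying [V2] to [V1], the reverse of the direction in
   [same_orbit V1 V2]. *)
suff V12 : V1 = act (Circle a1', \pi_(PU R d) W) V2.
  by rewrite same_orbit_sym; apply/asboolP; exists (Circle a1', \pi_(PU R d) W).
apply: val_inj; rewrite val_act /act_mx WV -scalemxAl scalerA mulrC.
by rewrite (circle_mulJ (Circle a1')) scale1r -mulmxA unitary_mulJ mulmx1.
Qed.

Lemma orbit_classP (V1 V2 : Virr R d k) :
  orbit_class V1 = orbit_class V2 <-> output_class V1 = output_class V2.
Proof.
by split=> /eqmodP/output_equivalentP ?; apply/eqmodP.
Qed.

(** Both spaces are quotients by the same relation. Each map sends a class to the other class of a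
    representative, and is continuous because the class map it uses is continuous and constant on
    classes. *)
Lemma Pirr_orbit_space_homeomorphism : exists f : Pirr R d k -> orbit_space R d k,
  homeomorphism f /\ forall V : Virr R d k, f (output_class V) = orbit_class V.
Proof.
pose f : Pirr R d k -> orbit_space R d k := @orbit_class R d k \o repr.
pose g : orbit_space R d k -> Pirr R d k := @output_class R d k \o repr.
have fE (V : Virr R d k) : f (output_class V) = orbit_class V.
  by apply/orbit_classP; exact: reprK.
have gE (V : Virr R d k) : g (orbit_class V) = output_class V.
  by apply/orbit_classP; exact: reprK.
exists f; split=> //; split.
  apply: repr_comp_continuous; first exact: pi_continuous.
  by move=> V1 V2 /eqP V12; apply/eqP/orbit_classP.
exists g; split.
- by move=> x; rewrite -[x]reprK [f _]fE [g _]gE.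
- by move=> x; rewrite -[x]reprK [g _]gE [f _]fE.
apply: repr_comp_continuous; first exact: pi_continuous.
by move=> V1 V2 /eqP V12; apply/eqP/orbit_classP.
Qed.

End OutputEquivalence.

Theorem theorem8 (R : realType) (d k : nat)
    (Virr_nonempty : Virr R d k !=set0) :
  [/\ effective_action R d k /\ almost_free_action R d k,
      forall V : Virr R d k,
        (exists (p : nat) (Z : unitary R d),
           is_period (val V) p /\ is_Z (val V) p Z) /\
        (forall (p : nat) (Z : unitary R d),
           is_period (val V) p -> is_Z (val V) p Z ->
           stabiliser V =
             [set (gamma R p ^+ j, \pi_(PU R d) Z ^+ j)%g | j in `I_p] /\
           isog_Zmod (stabiliser V) p)
    & exists f : Pirr R d k -> orbit_space R d k,
        homeomorphism f /\
        forall V : Virr R d k, f (output_class V) = orbit_class V].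
Proof.
split; last exact: Pirr_orbit_space_homeomorphism.
  split; first exact: effective_Virr.
  move=> V; have [p [Z [pV ZV]]] := period_Z_exists (set_mem (valP V)).
  exact: stabiliser_finite pV ZV.
move=> V; split; first exact: period_Z_exists (set_mem (valP V)).
move=> p Z pV ZV; split; last exact: stabiliser_cyclic pV ZV.
rewrite (stabiliser_powers pV ZV); apply/seteqP.
by split=> _ [j jp <-]; exists j => //; rewrite pair_expg.
Qed.
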